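(* For $n\ge 3$ let $P_n$ be the probability measure on the alternating group $A_n$ that assigns mass $\frac{1}{2n-3}$ to each of the identity, the $3$-cycles $(i,n-1,n)$ and the $3$-cycles $(i,n,n-1)$, $1\le i\le n-2$, and mass $0$ to all other elements. Then the family $\{(A_n,P_n)\}$ of random walks exhibits the total variation cutoff phenomenon, with cutoff at $\tau_n=(n-\frac32)\log n$.
   Context: For probability measures $p,q$ on a finite group $G$, the convolution is $(p*q)(x)=\sum_{y\in G}p(xy^{-1})q(y)$, and $p^{*k}$ is the $k$-fold convolution of $p$ with itself. The random walk on $G$ driven by $p$ is the Markov chain with state space $G$ and transition probabilities $M_p(x,y)=p(x^{-1}y)$. $U_G$ is the uniform distribution on $G$ and $\|\mu-\nu\|_{\mathrm{TV}}=\sup_{A\subset\Omega}|\mu(A)-\nu(A)|$. Let $\{G_n\}$ be a sequence of finite groups with probability measures $p_n$ on $G_n$ such that the random walk on $G_n$ driven by $p_n$ is irreducible and aperiodic. The family $\{(G_n,p_n)\}$ has the total variation cutoff phenomenon, with cutoff at $\tau_n$, if $\{\tau_n\}$ is a sequence of positive reals such that: (i) $\tau_n\to\infty$; (ii) for every $\epsilon\in(0,1)$ and $k_n=\lfloor(1+\epsilon)\tau_n\rfloor$, $\lim_{n\to\infty}\|p_n^{*k_n}-U_{G_n}\|_{\mathrm{TV}}=0$; (iii) for every $\epsilon\in(0,1)$ and $k_n=\lfloor(1-\epsilon)\tau_n\rfloor$, $\lim_{n\to\infty}\|p_n^{*k_n}-U_{G_n}\|_{\mathrm{TV}}=1$.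 *)

(* Defs.v *)
From mathcomp Require Import all_boot all_order all_fingroup all_algebra.
From mathcomp Require Import all_solvable.
From mathcomp Require Import all_classical all_reals all_analysis.

Set Implicit Arguments.
Unset Strict Implicit.
Unset Printing Implicit Defensive.

Import Order.TTheory GRing.Theory Num.Theory.
Import numFieldNormedType.Exports.

Local Open Scope classical_set_scope.
Local Open Scope ring_scope.

(* Measures on a finite group are represented by their mass functions. *)
Section FiniteGroupWalk.
Variables (R : realType) (G : finGroupType).
Implicit Types (p q mu nu : G -> R) (M : G -> G -> R) (A : {set G}).

Definition is_prob p : Prop := (forall x, 0 <= p x) /\ \sum_x p x = 1.

Definition uniform_dist : G -> R := fun _ => (#|G|%:R)^-1.

Definition point_mass (a : G) : G -> R := fun x => (x == a)%:R.

Definition convolution p q : G -> R :=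
  fun x => \sum_(y : G) p (x * y^-1)%g * q y.

(* The 0-fold convolution is the point mass at the identity, the unit for
   convolution. *)
Definition conv_pow p (k : nat) : G -> R :=
  iter k (convolution p) (point_mass 1%g).

Definition mass mu A : R := \sum_(x in A) mu x.

Definition tv_dist mu nu : R :=
  sup [set `|mass mu A - mass nu A| | A in [set: {set G}]].

Definition walk_kernel p : G -> G -> R := fun x y => p (x^-1 * y)%g.

Fixpoint kernel_pow M (k : nat) : G -> G -> R :=
  if k is k'.+1 then fun x y => \sum_(z : G) M x z * kernel_pow M k' z y
  else fun x y => (x == y)%:R.

Definition irreducible_chain M : Prop :=
  forall x y, exists k : nat, 0 < kernel_pow M k x y.

(* The greatest common divisor of the return times at each state is 1. *)
Definition aperiodic_chain M : Prop :=
  forall (x : G) (d : nat),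
    (forall k : nat, (0 < k)%N -> 0 < kernel_pow M k x x -> (d %| k)%N) ->
    d = 1%N.

End FiniteGroupWalk.

Arguments uniform_dist R G : clear implicits.

Definition tv_cutoff (R : realType) (G : nat -> finGroupType)
    (p : forall n, G n -> R) (tau : nat -> R) : Prop :=
  [/\ forall n, [/\ is_prob (p n), irreducible_chain (walk_kernel (p n))
                  & aperiodic_chain (walk_kernel (p n))],
      forall n, 0 < tau n,
      tau n @[n --> \oo] --> +oo,
      forall eps : R, 0 < eps < 1 ->
        tv_dist (conv_pow (p n) (Num.truncn ((1 + eps) * tau n)))
                (uniform_dist R (G n)) @[n --> \oo] --> (0 : R)
    & forall eps : R, 0 < eps < 1 ->
        tv_dist (conv_pow (p n) (Num.truncn ((1 - eps) * tau n)))
                (uniform_dist R (G n)) @[n --> \oo] --> (1 : R)].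

(* For distinct i, j, k this is the 3-cycle i -> j -> k -> i. *)
Definition three_cycle (T : finType) (i j k : T) : {perm T} :=
  (tperm i j * tperm i k)%g.

(* The label l in {1, ..., n} is the ordinal with value l - 1, so that a and b
   below are the labels n - 1 and n, and i ranges over the labels
   1, ..., n - 2. *)
Definition alt_generator (n : nat) (s : {perm 'I_n}) : bool :=
  [exists i : 'I_n, exists a : 'I_n, exists b : 'I_n,
    [&& i.+2 < n, a.+2 == n, b.+1 == n
      & (s == three_cycle i a b) || (s == three_cycle i b a)]]%N.

Definition alt_walk (R : realType) (n : nat) : [subg 'Alt_('I_n)] -> R :=
  fun x => if (x == 1%g) || alt_generator (sgval x)
           then (2 * n%:R - 3)^-1 else 0.

(* Main.v *)
(** A representation-theoretic L^2 estimate gives the upper bound and a coupon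
collector argument the lower one.

Upper bound. The sum of the identity and of the 3-cycles is
(J_{n-1} + J_n) (n-1 n), where the J_q = \sum_(l < q) (l q) are the commuting
Jucys-Murphy elements and (n-1 n) commutes with J_{n-1} + J_n; so |A_n| times the
return probability after 2k steps is half the trace of
((J_{n-1} + J_n) / (2n - 3)) ^ 2k in the regular representation of S_n. Call
contents the eigenvalues c_q of the J_q on a joint eigenvector v. Exchanging q
and q + 1 either multiplies v by 1 or -1, and then c_{q+1} = c_q + 1 or
c_q - 1, or gives a joint eigenvector with c_q and c_{q+1} exchanged. Taking the
first q at which a content exceeds d in a stable subspace Y, this forces
c_i = i - 1 for all i <= q, so that v, as a function on S_n, is invariant under
S_q, that is to say depends on n - q values of the permutation only. Hence on
the orthogonal complement of the functions of j values, and of the products of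
such functions with the sign, all contents are at most n - 2 - j in absolute
value, and |c_{n-1} + c_n| <= 2n - 5 - 2j. As these functions span a space of
dimension at most 2 n^(2j), the trace is at most
\sum_j 2 n^(2j) (1 - 2j / (2n - 3)) ^ 2k, whose terms for j >= 1 are dominated
by a geometric series that tends to 0 when k >= (1 + eps) (n - 3/2) ln n.

Lower bound. Each i <= n - 2 is moved by a step with probability
2 / (2n - 3), and the number of those not moved by any of k steps has a variance
bounded by its mean, which tends to infinity when
k <= (1 - eps) (n - 3/2) ln n; all of them are fixed points, while a uniform even
permutation has at most two fixed points on average. *)

Require Import Defs.
From mathcomp Require Import all_boot all_order all_fingroup all_algebra.
From mathcomp Require Import all_solvable.
From mathcomp Require Import all_classical all_reals all_analysis.
From mathcomp Require Import algC zify ring lra.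

Set Implicit Arguments.
Unset Strict Implicit.
Unset Printing Implicit Defensive.

Import Order.TTheory GRing.Theory Num.Theory.
Import numFieldNormedType.Exports.

Local Open Scope ring_scope.

(** * Jucys-Murphy elements in the regular representation *)

Section RegularRepresentation.
Variables (C : numClosedFieldType) (gT : finGroupType).
Local Open Scope sesquilinear_scope.

(** A row vector is read as a function v on the group; multiplied on the right by [regmx g], it
    becomes x -> v (g x). *)
Definition regmx (g : gT) : 'M[C]_#|gT| :=
  \matrix_(i, j) (enum_val i == g * enum_val j)%g%:R.

Lemma mul_regmxE m (A : 'M[C]_(m, #|gT|)) g i j :
  (A *m regmx g) i j = A i (enum_rank (g * enum_val j)%g).
Proof.
rewrite mxE (bigD1 (enum_rank (g * enum_val j)%g)) //= big1 ?addr0.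
  by rewrite mxE enum_rankK eqxx mulr1.
move=> k kNj; rewrite mxE; case: eqP => [kE|_]; last by rewrite mulr0.
by move: kNj; rewrite -kE enum_valK eqxx.
Qed.

Lemma regmxM : {morph regmx : g h / (g * h)%g >-> g *m h}.
Proof.
move=> g h; apply/matrixP => i j; rewrite mul_regmxE !mxE enum_rankK.
by rewrite mulgA.
Qed.

Lemma regmx1 : regmx 1%g = 1%:M.
Proof.
by apply/matrixP => i j; rewrite !mxE mul1g (inj_eq enum_val_inj).
Qed.

Lemma regmx_adj g : (regmx g)^t* = regmx g^-1.
Proof.
apply/matrixP => i j; rewrite !mxE conjC_nat; congr (nat_of_bool _)%:R.
by rewrite -[RHS](inj_eq (mulgI g)) mulKVg eq_sym.
Qed.

End RegularRepresentation.

Section JucysMurphy.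
Variables (C : numClosedFieldType) (n : nat).
Local Open Scope sesquilinear_scope.
Local Notation N := #|{perm 'I_n}|.
Local Notation rho := (@regmx C {perm 'I_n}).
Implicit Types (v w : 'rV[C]_N) (c : 'I_n -> C) (q : 'I_n) (g : {perm 'I_n}).

Definition jucys_murphy q : 'M[C]_N :=
  \sum_(l : 'I_n | (l < q)%N) rho (tperm l q).
Local Notation J := jucys_murphy.

Lemma tperm_shift (T : finType) (x y : T) (g : {perm T}) :
  (tperm x y * g = g * tperm (g x) (g y))%g.
Proof. by rewrite -tpermJ conjgE mulKVg. Qed.

(** Conjugation by [g] permutes the transpositions whose sum is [J q]. *)
Lemma jucys_murphy_commg g q : g q = q ->
  (forall l : 'I_n, (g l < q)%N = (l < q)%N) -> J q *m rho g = rho g *m J q.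
Proof.
move=> gq gl; rewrite mulmx_suml mulmx_sumr [RHS](reindex_inj (@perm_inj _ g)).
apply: eq_big => l; first by rewrite gl.
by move=> _; rewrite -!regmxM tperm_shift gq.
Qed.

Lemma jucys_murphy_comm p q : J p *m J q = J q *m J p.
Proof.
wlog pq : p q / (p < q)%N => [hw|].
  case: (ltngtP p q) => [/hw //|/hw -> //|/val_inj -> //].
rewrite [J p]/J mulmx_suml mulmx_sumr; apply: eq_bigr => l lp.
rewrite jucys_murphy_commg //.
  by rewrite tpermD // -val_eqE /=; lia.
by move=> k; case: tpermP => [->|->|//]; lia.
Qed.

Lemma jucys_murphy_adj q : (J q)^t* = J q.
Proof.
rewrite /J (raddf_sum (@trmx _ _ _)) (raddf_sum (map_mx Num.conj)).
by apply: eq_bigr => l _; rewrite /= regmx_adj tpermV.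
Qed.

Section Adjacent.
Variables i j : 'I_n.
Hypothesis ij : j = i.+1 :> nat.
Local Notation s := (tperm i j).

(** Conjugation by s turns J_i into J_j without its term s; multiplied by s, that term is the
    identity. *)
Lemma jucys_murphy_swapl : J i *m rho s = rho s *m J j - 1%:M.
Proof.
rewrite [J j](bigD1 i) /=; last by rewrite ij.
rewrite mulmxDr -regmxM tperm2 regmx1 addrC addKr.
rewrite mulmx_suml mulmx_sumr; apply: eq_big => l.
  by rewrite ij ltnS -val_eqE /=; lia.
move=> li; rewrite -!regmxM tperm_shift tpermL tpermD // -val_eqE /=; lia.
Qed.

Lemma jucys_murphy_swapr : J j *m rho s = rho s *m J i + 1%:M.
Proof.
have s2 : rho s *m rho s = 1%:M by rewrite -regmxM tperm2 regmx1.
have := congr1 (fun A => rho s *m A *m rho s) jucys_murphy_swapl.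
rewrite mulmxBr mulmx1 (mulmxA (rho s) (rho s)) s2 mul1mx mulmxBl s2.
by rewrite -(mulmxA (rho s)) -(mulmxA (J i)) s2 mulmx1 => ->; rewrite subrK.
Qed.

Lemma jucys_murphy_swapD q : q != i -> q != j ->
  J q *m rho s = rho s *m J q.
Proof.
move=> qi qj; rewrite jucys_murphy_commg //; first by rewrite tpermD 1?eq_sym.
move: qi qj; rewrite -!val_eqE /= => qi qj l.
by case: tpermP => [->|->|//]; lia.
Qed.

End Adjacent.
End JucysMurphy.
(** * Contents of joint eigenvectors *)

Section HermitianNorm.
Variables (C : numClosedFieldType).
Local Open Scope sesquilinear_scope.

Lemma dot_gt0 N (v : 'rV[C]_N) : v != 0 -> 0 < (v *m v^t*) 0 0.
Proof.
move=> vN0; rewrite mxE.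
have ge0 k : true -> 0 <= v 0 k * (v^t*) k 0 by rewrite !mxE mul_conjC_ge0.
rewrite lt0r sumr_ge0 // andbT psumr_neq0 //.
have [k vk] : exists k, v 0 k != 0.
  apply/existsP; apply: contraNT vN0 => /existsPn h; apply/eqP/rowP => k.
  by rewrite mxE; apply/eqP; rewrite -[_ == _]negbK h.
by apply/hasP; exists k; rewrite ?mem_index_enum //= !mxE mul_conjC_gt0.
Qed.

Lemma dot_ge0 N (v : 'rV[C]_N) : 0 <= (v *m v^t*) 0 0.
Proof.
have [->|/dot_gt0/ltW //] := eqVneq v 0.
by rewrite mul0mx mxE.
Qed.

Lemma adjM m n p (A : 'M[C]_(m, n)) (B : 'M[C]_(n, p)) :
  (A *m B)^t* = B^t* *m A^t*.
Proof. by rewrite trmx_mul map_mxM. Qed.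

Lemma adjZ m n (a : C) (A : 'M[C]_(m, n)) : (a *: A)^t* = a^* *: A^t*.
Proof. by apply/matrixP => i j; rewrite !mxE rmorphM. Qed.

End HermitianNorm.

Section Contents.
Variables (C : numClosedFieldType) (n : nat).
Local Open Scope sesquilinear_scope.
Local Notation N := #|{perm 'I_n}|.
Local Notation rho := (@regmx C {perm 'I_n}).
Local Notation J := (@jucys_murphy C n).
Implicit Types (v w : 'rV[C]_N) (c : 'I_n -> C) (i j q : 'I_n).

Definition content_vector v c : Prop :=
  v != 0 /\ forall q, v *m J q = c q *: v.

Lemma content_conj v c q : content_vector v c -> (c q)^* = c q.
Proof.
move=> [vN0 vJ]; have v2 := lt0r_neq0 (dot_gt0 vN0).
have : (v *m J q *m v^t*) 0 0 = (v *m (v *m J q)^t*) 0 0.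
  by rewrite adjM jucys_murphy_adj mulmxA.
by rewrite vJ -scalemxAl adjZ -scalemxAr mxE [RHS]mxE => /(mulIf v2).
Qed.

Lemma content_real v c q : content_vector v c -> c q \is Num.real.
Proof. by move=> /content_conj h; apply/CrealP/h. Qed.

Lemma content_first v c q : content_vector v c -> q = 0 :> nat -> c q = 0.
Proof.
move=> [vN0 vJ] q0; have := vJ q; rewrite /J big_pred0 ?mulmx0; last first.
  by move=> l; rewrite q0.
by move/eqP; rewrite eq_sym scaler_eq0 (negPf vN0) orbF => /eqP.
Qed.

Section Adjacent.
Variables i j : 'I_n.
Hypothesis ij : j = i.+1 :> nat.
Local Notation s := (tperm i j).
Variables (v : 'rV[C]_N) (c : 'I_n -> C).
Hypothesis vc : content_vector v c.

Let ss : rho s *m rho s = 1%:M.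
Proof. by rewrite -regmxM tperm2 regmx1. Qed.

Let sadj : (rho s)^t* = rho s.
Proof. by rewrite regmx_adj tpermV. Qed.

Lemma content_swapl : v *m rho s *m J i = c j *: (v *m rho s) - v.
Proof.
rewrite -mulmxA -[rho s *m J i](addrK 1%:M) -(jucys_murphy_swapr _ ij).
by rewrite mulmxBr mulmxA vc.2 mulmx1 scalemxAl.
Qed.

Lemma content_swapr : v *m rho s *m J j = c i *: (v *m rho s) + v.
Proof.
rewrite -mulmxA -[rho s *m J j](subrK 1%:M) -(jucys_murphy_swapl _ ij).
by rewrite mulmxDr mulmxA vc.2 mulmx1 scalemxAl.
Qed.

(** J_j is self-adjoint, so in the inner product of v s J_j with v it can act on either side. *)
Lemma content_swap_dot :
  (c j - c i) * (v *m rho s *m v^t*) 0 0 = (v *m v^t*) 0 0.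
Proof.
have : (v *m rho s *m J j *m v^t*) 0 0 = (v *m rho s *m (v *m J j)^t*) 0 0.
  by rewrite adjM jucys_murphy_adj !mulmxA.
rewrite content_swapr vc.2 adjZ (content_conj _ vc) mulmxDl -scalemxAl.
rewrite -scalemxAr [LHS]mxE [X in X + _]mxE [RHS]mxE mulrBl => <-.
by rewrite addrAC subrr add0r.
Qed.

(** As s is a unitary involution, the inner product b of v s and v satisfies |b| <= a, where a is
    the squared norm of v; by [content_swap_dot], (c_j - c_i) b = a. *)
Lemma content_gap : 1 <= `|c j - c i|.
Proof.
have a_gt0 := dot_gt0 vc.1; have := content_swap_dot.
set a := (v *m v^t*) 0 0 in a_gt0 *; set b := (v *m _ *m _) 0 0 => dba.
have b2 : (v *m (v *m rho s)^t*) 0 0 = b by rewrite adjM sadj mulmxA.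
have a2 : (v *m rho s *m (v *m rho s)^t*) 0 0 = a.
  by rewrite adjM sadj mulmxA -(mulmxA v) ss mulmx1.
(* The squared norm of v s + e v, to be used with e = 1 and e = -1. *)
have pm e : e^* = e -> e * e = 1 -> 0 <= a + a + e * (b + b).
  move=> ee e2; have := dot_ge0 (v *m rho s + e *: v).
  have -> : (v *m rho s + e *: v)^t* = (v *m rho s)^t* + e *: v^t*.
    by apply/matrixP => x y; rewrite !mxE rmorphD rmorphM /= ee.
  rewrite mulmxDl !mulmxDr -!scalemxAl -!scalemxAr scalerA e2 scale1r.
  have D (A B : 'M[C]_1) : (A + B) 0 0 = A 0 0 + B 0 0 by rewrite mxE.
  have Z (x : C) (A : 'M[C]_1) : (x *: A) 0 0 = x * A 0 0 by rewrite mxE.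
  rewrite !D !Z a2 b2 -/a -/b.
  by congr (0 <= _); ring.
have := pm 1 (conjC1 _) (mulr1 _).
have := pm (-1); rewrite conjCN1 mulrNN mulr1 => /(_ erefl erefl).
rewrite mul1r mulN1r subr_ge0 -!mulr2n lerMn2r /= => ba.
rewrite -mulrnDl pmulrn_lge0 // => ab.
have nb : `|b| <= a.
  have bR : b \is Num.real.
    by rewrite (ler_real ba); apply: gtr0_real.
  rewrite (real_ler_norml _ bR) ba andbT.
  by rewrite -subr_ge0 opprK addrC.
have : `|c j - c i| * `|b| = a by rewrite -normrM dba gtr0_norm.
move=> e; rewrite -(ler_pM2r a_gt0) mul1r -{1}e ler_wpM2l //.
Qed.

(** The span of v and v s is stable under J_i and J_j, and w = v s - v / (c_j - c_i), unless it
    vanishes, has the two contents exchanged. If w = 0 then v is an eigenvector of s, and s^2 = 1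
    leaves only the eigenvalues 1 and -1. *)
Lemma content_trichotomy p (Y : 'M[C]_(p, N)) :
    (forall g, stablemx Y (rho g)) -> (v <= Y)%MS ->
  [\/ c j = c i + 1 /\ v *m rho s = v,
      c j = c i - 1 /\ v *m rho s = - v
    | exists w c', [/\ content_vector w c', (w <= Y)%MS, c' i = c j, c' j = c i
                     & forall q, q != i -> q != j -> c' q = c q]].
Proof.
move=> Yst vY; pose d := c j - c i.
have dN0 : d != 0.
  apply/eqP => d0; have := content_swap_dot; rewrite -/d d0 mul0r => /esym/eqP.
  by rewrite (negPf (lt0r_neq0 (dot_gt0 vc.1))).
pose w := v *m rho s - d^-1 *: v.
have [w0|wN0] := eqVneq w 0.
  have vs : v *m rho s = d^-1 *: v by apply/eqP; rewrite -subr_eq0 -/w w0.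
  have : (d^-1 ^+ 2 - 1) *: v = 0.
    rewrite scalerBl scale1r expr2 -scalerA -vs scalemxAl -vs -mulmxA ss mulmx1.
    by rewrite subrr.
  move/eqP; rewrite scaler_eq0 (negPf vc.1) orbF subr_sqr_1 mulf_eq0.
  rewrite subr_eq0 addr_eq0 => /orP[]/eqP dE; [apply: Or31|apply: Or32].
    rewrite vs dE scale1r; split=> //.
    by rewrite -[1]invr1 -dE invrK /d addrC subrK.
  rewrite vs dE scaleN1r; split=> //.
  by rewrite -invrN1 -dE invrK /d addrC subrK.
apply: Or33.
exists w, (fun q => if q == i then c j else if q == j then c i else c q).
have jNi : (j == i) = false by rewrite -val_eqE /= ij; lia.
rewrite eqxx jNi eqxx; split=> // [|| q /negPf -> /negPf -> //]; last first.
  rewrite /w -scaleNr addmx_sub //; last exact: scalemx_sub.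
  exact: submx_trans (submxMr _ vY) (Yst s).
split=> // q; rewrite mulmxBl -scalemxAl vc.2.
have [->|qi] := eqVneq q i.
  rewrite content_swapl /w; move: (v *m rho s) => t; apply/rowP => k.
  by rewrite !mxE; move: dN0; rewrite /d => dN0; field.
have [->|qj] := eqVneq q j.
  rewrite content_swapr /w; move: (v *m rho s) => t; apply/rowP => k.
  by rewrite !mxE; move: dN0; rewrite /d => dN0; field.
rewrite -mulmxA -jucys_murphy_swapD // mulmxA vc.2 -scalemxAl.
by rewrite scalerBr !scalerA [d^-1 * _]mulrC.
Qed.

End Adjacent.
End Contents.

(** * Joint eigenvectors with an extremal content *)

Section ExtremalContent.
Variables (C : numClosedFieldType) (n : nat).
Local Notation N := #|{perm 'I_n}|.
Local Notation rho := (@regmx C {perm 'I_n}).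
Implicit Types (v w : 'rV[C]_N) (c : 'I_n -> C) (i j q : 'I_n).

Lemma tperm_braid (T : finType) (x y z : T) : x != y -> y != z -> x != z ->
  (tperm x y * tperm y z * tperm x y = tperm y z * tperm x y * tperm y z)%g.
Proof.
move=> xy yz xz; rewrite tperm_shift tpermL (@tpermD _ y z x) 1?eq_sym //.
by rewrite -mulgA (tperm_shift x z) tpermL (@tpermD _ x y z) ?mulgA.
Qed.

(** Induction on i - l: (l i) is the conjugate of (l i-1) by (i-1 i). *)
Lemma eq_tperm_adjacent (v : 'rV[C]_N) q :
    (forall i j : 'I_n, j = i.+1 :> nat -> (j <= q)%N ->
      v *m rho (tperm i j) = v) ->
  forall l i : 'I_n, (l < i <= q)%N -> v *m rho (tperm l i) = v.
Proof.
move=> adj l i; have [m] := ubnP (i - l)%N.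
elim: m i => // m IHm i; rewrite ltnS => im /andP[li iq].
have [il|il] := eqVneq (i : nat) l.+1; first exact: adj.
have i0 : (i.-1 < n)%N by have := ltn_ord i; lia.
pose i' := Ordinal i0.
have ii' : i = i'.+1 :> nat by rewrite /=; lia.
have lE : tperm l i = (tperm i' i * tperm l i' * tperm i' i)%g.
  rewrite -mulgA (tperm_shift l i') tpermL (@tpermD _ i' i l) -?val_eqE /=;
    [|lia..].
  by rewrite mulgA tperm2 mul1g.
have v1 : v *m rho (tperm i' i) = v by apply: adj.
rewrite lE !regmxM !mulmxA v1 IHm ?v1 //=; lia.
Qed.

Variables (p : nat) (Y : 'M[C]_(p, N)).
Hypothesis Yst : forall g, stablemx Y (rho g).
Variable P : pred C.
Hypothesis Pdown : forall x, P (x + 1) -> P x.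

(* Induction downwards from the first index q where a content violates P: any
   other value of the previous content could be swapped with the next one,
   producing a content vector that is excluded, or would contradict the braid
   relation. *)
Lemma extremal_content q :
    (forall i v c, (i < q)%N -> content_vector v c -> (v <= Y)%MS -> P (c i)) ->
  forall k i v c, (i + k = q)%N -> content_vector v c -> (v <= Y)%MS ->
    ~~ P (c q) ->
  c i + k%:R = c q /\
  forall i' j' : 'I_n, j' = i'.+1 :> nat -> (i <= i')%N -> (j' <= q)%N ->
    v *m rho (tperm i' j') = v.
Proof.
move=> Pmin; elim=> [|k IHk] i v c.
  rewrite addn0 => /val_inj -> _ _ _.
  split=> [|i' j' ->]; first by rewrite addr0.
  by move=> qi iq; have := leq_ltn_trans qi iq; rewrite ltnn.
move=> ik vc vY NPq.
have j0 : (i.+1 < n)%N by have := ltn_ord q; lia.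
pose j := Ordinal j0; have ij : j = i.+1 :> nat by [].
have jk : (j + k = q)%N by rewrite /=; lia.
have [cj inv] := IHk j v c jk vc vY NPq.
case: (content_trichotomy ij vc Yst vY) => [[cij vs]|[cij vs]|].
- split; first by rewrite -cj cij -natr1 addrA addrAC.
  move=> i' j' ij' ii' jq'; have [i'i|i'i] := eqVneq i' i.
    by have -> : j' = j; [apply: val_inj; rewrite /= ij' i'i | rewrite i'i].
  apply: inv => //=; move: i'i; rewrite -val_eqE /=; lia.
- case: k => [|k] in ik IHk jk cj inv *.
    have jq : j = q by apply: val_inj; rewrite /= -jk addn0.
    case/negP: NPq; rewrite -jq cij; apply: Pdown; rewrite subrK.
    by apply: Pmin vc vY; lia.
  (* Here v is negated by (i j) and fixed by (j j'), so the two sides of the braid relation send it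
     to v and to -v. *)
  have j0' : (j.+1 < n)%N by have := ltn_ord q; lia.
  pose j' := Ordinal j0'.
  have vs' : v *m rho (tperm j j') = v by apply: inv => //=; lia.
  have /(congr1 (fun g => v *m rho g)) :
      (tperm i j * tperm j j' * tperm i j
       = tperm j j' * tperm i j * tperm j j')%g.
    by apply: tperm_braid; rewrite -val_eqE /=; lia.
  rewrite !regmxM !mulmxA vs vs' !mulNmx vs' vs opprK mulNmx vs' => /eqP.
  rewrite -addr_eq0 -mulr2n -scaler_nat scaler_eq0 pnatr_eq0 /=.
  by rewrite (negPf vc.1).
case=> w [c' [wc wY c'i c'j c'q]].
case: k => [|k] in ik IHk jk cj inv *.
  have jq : j = q by apply: val_inj; rewrite /= -jk addn0.
  case/negP: NPq; rewrite -jq -c'i; apply: Pmin wc wY; lia.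
(* The induction hypothesis, applied to [w] and to [v], gives c_i = c'_j = c_j, against
   [content_gap]. *)
have cq : c' q = c q by apply: c'q; rewrite -val_eqE /=; lia.
have [] := IHk j w c' jk wc wY; rewrite cq // c'j -cj => /addIr cij _.
by have := content_gap ij vc; rewrite cij subrr normr0 ler10.
Qed.

(** Strong induction on q: the contents before q satisfy P, so if c_q did not, [extremal_content]
    started at the first index, where the content is 0, would give c_q = q and a vector fixed by all
    transpositions of indices up to q. The hypothesis says that P q holds in that case. *)
Lemma content_bound :
    (forall q v, v != 0 -> (v <= Y)%MS ->
      (forall l i : 'I_n, (l < i <= q)%N -> v *m rho (tperm l i) = v) ->
      P q%:R) ->
  forall v c q, content_vector v c -> (v <= Y)%MS -> P (c q).
Proof.
move=> Pinv v c q; have [m] := ubnP q; elim: m q v c => // m IHm q v c.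
rewrite ltnS => qm vc vY; apply: contraT => NPq.
have n0 : (0 < n)%N by have := ltn_ord q; lia.
have Pmin i v' c' : (i < q)%N -> content_vector v' c' -> (v' <= Y)%MS ->
    P (c' i) by move=> iq; apply: IHm; lia.
have [] := extremal_content Pmin (i := Ordinal n0) (k := q) _ vc vY NPq => //.
rewrite (content_first vc) // add0r => cq inv.
rewrite -cq in NPq; case/negP: NPq; apply: (Pinv q v vc.1 vY).
by apply: eq_tperm_adjacent => i j ij jq; apply: inv.
Qed.

End ExtremalContent.

(** * Functions of few values of a permutation *)

Section Juntas.
Variables (C : numClosedFieldType) (n j : nat).
Local Notation N := #|{perm 'I_n}|.
Local Notation rho := (@regmx C {perm 'I_n}).
Implicit Types (v w : 'rV[C]_N) (c : 'I_n -> C) (i q : 'I_n).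
Implicit Types (g x y : {perm 'I_n}).

(** The bit tells whether to multiply by the sign; the two functions give the positions a_k and the
    values prescribed there. *)
Definition junta_index :=
  (bool * ({ffun 'I_j -> 'I_n} * {ffun 'I_j -> 'I_n}))%type.

Definition junta (t : junta_index) x : C :=
  (-1) ^+ (t.1 && odd_perm x) * [forall k, x (t.2.1 k) == t.2.2 k]%:R.

(* The columns span the functions of the values x (a_1), ..., x (a_j), for all
   choices of the a_k, and the products of such functions with the sign. *)
Definition junta_mx : 'M[C]_(N, #|{: junta_index}|) :=
  \matrix_(k, t) junta (enum_val t) (enum_val k).
Local Notation Y := (kermx junta_mx).

Lemma card_junta_index : #|{: junta_index}| = (2 * n ^ (2 * j))%N.
Proof.
by rewrite !card_prod card_bool !card_ffun !card_ord -expnD addnn -mul2n.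
Qed.

(** [Y] consists of the vectors orthogonal to all juntas. Translation by g^-1 sends a junta to a
    junta, up to sign, with its positions moved by g^-1. *)
Lemma junta_kernel_stable g : stablemx Y (rho g).
Proof.
apply/sub_kermxP/matrixP => i t; set A := kermx _.
pose s := enum_val t.
pose s' : junta_index := (s.1, ([ffun k => g^-1%g (s.2.1 k)], s.2.2)).
have sE x : junta s (g^-1 * x)%g = (-1) ^+ (s.1 && odd_perm g) * junta s' x.
  rewrite /junta /= odd_permM odd_permV mulrA; congr (_ * _%:R).
    by rewrite -signr_addb; case: s.1.
  by congr (nat_of_bool _); apply: eq_forallb => k; rewrite permM ffunE.
transitivity ((-1) ^+ (s.1 && odd_perm g) * (A *m junta_mx) i (enum_rank s')).
  rewrite -mulmxA mxE [(A *m junta_mx) i _]mxE mulr_sumr; apply: eq_bigr => k _.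
  rewrite mulrCA; congr (_ * _); rewrite [in RHS]mxE enum_rankK -sE.
  rewrite mxE (bigD1 (enum_rank (g^-1 * enum_val k)%g)) //= big1 ?addr0.
    by rewrite !mxE enum_rankK mulKVg eqxx mul1r.
  move=> l lN; rewrite mxE; case: eqP => [kE|_]; last by rewrite mul0r.
  by move: lN; rewrite kE mulKg enum_valK eqxx.
by rewrite mulmx_ker !mxE mulr0.
Qed.

Definition sign_mx : 'M[C]_N :=
  diag_mx (\row_k (-1) ^+ odd_perm (enum_val k : {perm 'I_n})).

Lemma mul_sign_mxE m (A : 'M[C]_(m, N)) k l :
  (A *m sign_mx) k l = (-1) ^+ odd_perm (enum_val l : {perm 'I_n}) * A k l.
Proof. by rewrite mul_mx_diag !mxE mulrC. Qed.

(* Multiplying by the sign reduces lower bounds on contents to upper bounds. *)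
Lemma sign_twist v c : content_vector v c ->
  content_vector (v *m sign_mx) (fun q => - c q).
Proof.
move=> [vN0 vJ]; split.
  apply: contraNneq vN0 => v0; apply/eqP/rowP => k.
  have := congr1 (fun A : 'rV[C]_N => A 0 k) v0.
  by rewrite mul_sign_mxE !mxE => /eqP; rewrite mulf_eq0 signr_eq0 => /eqP.
move=> q; rewrite scaleNr [in RHS]scalemxAl -vJ.
rewrite /jucys_murphy !mulmx_sumr mulmx_suml -sumrN; apply: eq_bigr => l lq.
apply/rowP => k; rewrite mul_regmxE !mul_sign_mxE mxE mul_sign_mxE.
rewrite mul_regmxE enum_rankK odd_permM odd_tperm -val_eqE /= ltn_eqF //=.
by rewrite signrN mulNr.
Qed.

Section SignStable.
Variables (p : nat) (Y : 'M[C]_(p, N)) (d : C).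
Hypothesis Yst : forall g, stablemx Y (rho g).
Hypothesis Ysign : stablemx Y sign_mx.
Hypothesis Yinv : forall q v, v != 0 -> (v <= Y)%MS ->
  (forall l i : 'I_n, (l < i <= q)%N -> v *m rho (tperm l i) = v) -> q%:R <= d.

Lemma content_norm v c q : content_vector v c -> (v <= Y)%MS -> `|c q| <= d.
Proof.
move=> vc vY; pose P := [pred x : C | x <= d].
have Pdown (x : C) : P (x + 1) -> P x by apply: le_trans; rewrite lerDl ler01.
have bound := content_bound Yst Pdown Yinv.
have vY' : (v *m sign_mx <= Y)%MS by apply: submx_trans (submxMr _ vY) Ysign.
rewrite real_ler_norml ?(content_real _ vc) // lerNl; apply/andP; split.
  exact: bound (sign_twist vc) vY'.
exact: bound vc vY.
Qed.

(** Two numbers of [-d, d] at distance at least 1 have a sum of absolute value at most d + (d -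
    1). *)
Lemma content_norm2 v c q q' : q' = q.+1 :> nat ->
  content_vector v c -> (v <= Y)%MS -> `|c q + c q'| <= 2 * d - 1.
Proof.
move=> qq' vc vY.
have [qR q'R] := (content_real q vc, content_real q' vc).
have := content_norm q vc vY; have := content_norm q' vc vY.
have := content_gap qq' vc; rewrite real_ler_normr ?realB //.
rewrite !real_ler_norml ?realD //.
have -> : 2 * d - 1 = (d - 1) + d by ring.
have -> : - ((d - 1) + d) = (1 - d) + - d by ring.
have H (x y : C) : 1 + x <= y -> - d <= x -> y <= d ->
    (1 - d) + - d <= x + y <= (d - 1) + d.
  move=> xy dx yd; apply/andP; split; last first.
    by apply: lerD => //; rewrite lerBrDr addrC (le_trans xy).
  rewrite [x + y]addrC; apply: lerD => //; apply: le_trans xy.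
  by rewrite lerD2l.
move=> gap /andP[l' u'] /andP[l u].
case/orP: gap; rewrite ?(opprB (c _)) lerBrDr.
  by move=> /H; apply.
by rewrite [c q + _]addrC => /H; apply.
Qed.

End SignStable.

(** Multiplication by the sign flips the bit of a junta index. *)
Lemma junta_kernel_sign_stable : stablemx Y sign_mx.
Proof.
apply/sub_kermxP/matrixP => i t; set A := kermx _; pose s := enum_val t.
have : (A *m junta_mx) i (enum_rank (~~ s.1, s.2)) = 0.
  by rewrite mulmx_ker mxE.
rewrite mxE => vs0; rewrite mxE [RHS]mxE -[RHS]vs0.
apply: eq_bigr => k _; rewrite mul_sign_mxE mulrAC mulrC; congr (_ * _).
rewrite !mxE enum_rankK /junta /= -/s mulrA; congr (_ * _).
by rewrite -signr_addb; case: s.1; case: (odd_perm _).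
Qed.

(** Induction on the number r of first positions at which x and y may differ. Composing x with (l
    k), where l is the position at which x takes the value y k, leaves v unchanged and makes the two
    permutations agree at k too. *)
Lemma eq_agree_above v q :
    (forall l i : 'I_n, (l < i <= q)%N -> v *m rho (tperm l i) = v) ->
  forall x y, (forall i, (q < i)%N -> x i = y i) ->
  v 0 (enum_rank x) = v 0 (enum_rank y).
Proof.
move=> inv x y xy.
suff H r : (r <= q.+1)%N -> forall x, (forall i, (r <= i)%N -> x i = y i) ->
    v 0 (enum_rank x) = v 0 (enum_rank y) by apply: (H q.+1).
elim: r => [|r IHr] rq {xy} {}x xy.
  by congr (v 0 (enum_rank _)); apply/permP => i; apply: xy.
have rn : (r < n)%N by have := ltn_ord q; lia.
pose k := Ordinal rn; pose l := (x^-1)%g (y k).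
have xl : x l = y k by rewrite /l permKV.
have lk : (l <= k)%N.
  rewrite leqNgt; apply/negP => kl; move: (kl); rewrite xy // in xl.
  by rewrite (perm_inj xl) ltnn.
have [lk'|lNk] := eqVneq l k.
  apply: IHr => [|i]; first exact: ltnW.
  rewrite leq_eqVlt => /orP[/eqP ri|]; last exact: xy.
  by have -> : i = k; [apply: val_inj | rewrite -xl lk'].
transitivity (v 0 (enum_rank (tperm l k * x)%g)).
  rewrite -{1}(inv l k) ?mul_regmxE ?enum_rankK //.
  by rewrite ltn_neqAle lNk lk.
apply: IHr => [|i]; first exact: ltnW.
rewrite permM leq_eqVlt => /orP[/eqP ri|ri].
  have -> : i = k by apply: val_inj.
  by rewrite tpermR.
by rewrite tpermD ?xy // -val_eqE /=; move: lk => /=; lia.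
Qed.

(** Otherwise at most j indices exceed q, and v depends on the values at these indices only. It is
    then constant on the support of the junta that prescribes the values of x0 there, so
    orthogonality to this junta forces v x0 = 0. *)
Lemma junta_kernel_invariant v q : v != 0 -> (v <= Y)%MS ->
    (forall l i : 'I_n, (l < i <= q)%N -> v *m rho (tperm l i) = v) ->
  (q + j.+2 <= n)%N.
Proof.
move=> vN0 /sub_kermxP vK inv; rewrite leqNgt; apply/negP => nqj.
case/eqP: vN0; apply/rowP => k; rewrite [RHS]mxE -[k]enum_valK.
set x0 := enum_val k.
(* Positions beyond the last index default to q; the junta then also prescribes the value at q, and
   its support still contains x0. *)
pose a := [ffun k : 'I_j => insubd q (q.+1 + k)%N].
pose s : junta_index := (false, (a, [ffun k => x0 (a k)])).
have sx0 : junta s x0 = 1.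
  rewrite /junta /= mul1r; case: forallP => // -[] l.
  by rewrite [in X in _ == X]ffunE.
have := congr1 (fun A : 'rV[C]__ => A 0 (enum_rank s)) vK.
rewrite mxE [RHS]mxE.
rewrite (eq_bigr (fun l => v 0 (enum_rank x0) * junta s (enum_val l))).
  rewrite -mulr_sumr => /eqP; rewrite mulf_eq0 => /orP[/eqP //|].
  rewrite psumr_eq0 => [|l _]; last by rewrite /junta /= mul1r ler0n.
  move/allP/(_ (enum_rank x0) (mem_index_enum _)).
  by rewrite enum_rankK sx0 oner_eq0.
move=> l _; rewrite [junta_mx _ _]mxE enum_rankK -{1}[l]enum_valK.
rewrite /junta /= !mul1r; case: forallP => [agree|]; last by rewrite !mulr0.
congr (_ * _); apply: eq_agree_above inv _ _ _ => i qi.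
have ij : (i - q.+1 < j)%N by have := ltn_ord i; lia.
have := agree (Ordinal ij); rewrite !ffunE.
have -> : insubd q (q.+1 + Ordinal ij)%N = i.
  by apply: val_inj; rewrite val_insubd /= subnKC // ltn_ord.
by move/eqP.
Qed.

Lemma junta_kernel_content2 v c q q' : q' = q.+1 :> nat ->
  content_vector v c -> (v <= Y)%MS ->
  `|c q + c q'| <= 2 * (n%:R - j.+2%:R) - 1.
Proof.
apply: content_norm2 junta_kernel_stable junta_kernel_sign_stable _ _ _ _ _.
move=> i w wN0 wY inv; rewrite lerBrDr -natrD ler_nat.
exact: junta_kernel_invariant inv.
Qed.

Lemma content2_le v c q q' : q' = q.+1 :> nat -> content_vector v c ->
  `|c q + c q'| <= 2 * (n%:R - 1) - 1.
Proof.
move=> qq' vc; apply: (@content_norm2 _ 1%:M) vc (submx1 _) => //.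
- by move=> g; apply: submx1.
- exact: submx1.
- by move=> i w _ _ _; rewrite lerBrDr natr1 ler_nat.
Qed.

End Juntas.
(** * Trace of the powers of a sum of two Jucys-Murphy elements *)

Lemma common_eigenvector_sub (C : numClosedFieldType) N (Z : 'M[C]_N)
    (As : seq 'M[C]_N) :
    Z != 0 -> {in As, forall A, stablemx Z A} ->
    {in As &, forall A B, comm_mx A B} ->
  exists2 v : 'rV_N, v != 0 & (v <= Z)%MS /\ {in As, forall A, stablemx v A}.
Proof.
move=> Z0 Zst As_comm.
have [||u u0 /allP uP] :=
  @common_eigenvector C _ [seq restrictmx Z A | A <- As].
- by rewrite lt0n mxrank_eq0.
- move=> _ _ /mapP[A AAs ->] /mapP[B BAs ->].
  by rewrite /comm_mx -!conjmxM ?inE ?stablemx_row_base ?Zst // As_comm.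
exists (u *m row_base Z); first by rewrite mulmx_free_eq0 ?row_base_free.
split; first by rewrite mulmx_sub // eq_row_base.
by move=> A AAs; rewrite -stablemx_restrict ?Zst // uP // map_f.
Qed.

Lemma row_diag_mulmx (F : pzSemiRingType) m p (d : 'rV[F]_m)
    (A : 'M[F]_(m, p)) k :
  row k (diag_mx d *m A) = d 0 k *: row k A.
Proof. by apply/rowP => l; rewrite mul_diag_mx !mxE. Qed.

Section TraceBound.
Variables (C : numClosedFieldType) (n : nat).
Local Open Scope sesquilinear_scope.
Local Notation N := #|{perm 'I_n}|.
Local Notation J := (@jucys_murphy C n).

(** The J_i commute and are self-adjoint, hence are diagonalized together; the rows of [P] are
    content vectors. *)
Lemma jucys_murphy_diag : exists2 P : 'M[C]_N, P \in unitmx &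
  exists D : 'I_n -> 'rV[C]_N, forall i, P *m J i = diag_mx (D i) *m P.
Proof.
pose As := [seq J i | i <- enum 'I_n].
have /codiagonalizableP[P Pu /allP Pd] :
    {in As &, forall A B, comm_mx A B} /\ {in As, forall A, diagonalizable A}.
  split=> [A B|A] /mapP[i _ ->].
    by move=> /mapP[k _ ->]; apply: jucys_murphy_comm.
  have /orthomx_spectralP -> : J i \is normalmx.
    by apply/normalmxP; rewrite jucys_murphy_adj.
  exists (spectralmx (J i)); first exact: spectral_unit.
  apply/(diagonalizable_forLR (spectral_unit _)).
  by exists (spectral_diag (J i)); rewrite mxpoly.conjVmx ?spectral_unit.
exists P => //.
apply: (@fin_all_exists _ _ (fun i D => P *m J i = diag_mx D *m P)) => i.
have /Pd/diagonalizable_forPex[D /(simmxP Pu) PD] : J i \in As.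
  by rewrite map_f ?mem_enum.
by exists D.
Qed.

Section Counting.
Variables (P : 'M[C]_N) (D : 'I_n -> 'rV[C]_N).
Hypotheses (Pu : P \in unitmx) (PJ : forall i, P *m J i = diag_mx (D i) *m P).
Variables (q q' : 'I_n).
Hypothesis qq' : q' = q.+1 :> nat.

Lemma row_content k : content_vector (row k P) (fun i => D i 0 k).
Proof.
split=> [|i].
  apply/eqP => /(congr1 (mulmx^~ (invmx P))); rewrite mul0mx -row_mul mulmxV //.
  by move/rowP/(_ k); rewrite !mxE eqxx => /eqP; rewrite oner_eq0.
by rewrite -row_mul PJ row_diag_mulmx.
Qed.

(** Dimension count: were there more such rows than juntas, some nonzero combination of them would
    be orthogonal to all juntas. These combinations form a space stable under the J_i, hence contain
    a joint eigenvector; its contents are those of any row that occurs in it, which contradicts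
    [junta_kernel_content2]. *)
Lemma card_large_content (j : nat) :
  (#|[set k | ~~ (`|D q 0 k + D q' 0 k| <= 2 * (n%:R - j.+2%:R) - 1)%R]|
    <= 2 * n ^ (2 * j))%N.
Proof.
set I := [set k | _]; rewrite -card_junta_index leqNgt; apply/negP => ltI.
pose K := junta_mx C n j.
pose E := rowsub (enum_val : 'I_#|I| -> 'I_N) P.
pose Dl i : 'M[C]_#|I| := diag_mx (\row_k D i 0 (enum_val k)).
have EJ i : E *m J i = Dl i *m E.
  have rE k : row k E = row (enum_val k) P by rewrite row_rowsub.
  apply/row_matrixP => k.
  by rewrite row_mul rE -row_mul PJ !row_diag_mulmx rE mxE.
pose Z := kermx (E *m K).
have Z0 : Z != 0.
  rewrite -mxrank_eq0 mxrank_ker subn_eq0 -ltnNge.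
  exact: leq_ltn_trans (rank_leq_col _) ltI.
have Zst i : stablemx Z (Dl i).
  apply/sub_kermxP; rewrite mulmxA -(mulmxA Z) -EJ mulmxA.
  have ZE : (Z *m E <= kermx K)%MS.
    by apply/sub_kermxP; rewrite -mulmxA mulmx_ker.
  apply/sub_kermxP; apply: submx_trans (submxMr _ ZE) _.
  rewrite /jucys_murphy mulmx_sumr summx_sub // => l _.
  exact: junta_kernel_stable.
have Zcomm : {in [seq Dl i | i <- enum 'I_n] &, forall A B, comm_mx A B}.
  by move=> _ _ /mapP[i _ ->] /mapP[k _ ->]; rewrite /comm_mx diag_mxC.
have [|u u0 [uZ /(_ _ _)/eigenvectorP uD]] := common_eigenvector_sub Z0 _ Zcomm.
  by move=> _ /mapP[i _ ->].
have {uD} [a ua] : exists a : 'I_n -> C, forall i, u *m Dl i = a i *: u.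
  apply: (@fin_all_exists _ _ (fun i a => u *m Dl i = a *: u)) => i.
  have [|a /eigenspaceP ua] := uD (Dl i); first by rewrite map_f ?mem_enum.
  by exists a.
have uE : content_vector (u *m E) a.
  split=> [|i]; last by rewrite -mulmxA EJ mulmxA ua scalemxAl.
  apply: contra u0 => /eqP /(congr1 (mulmx^~ (invmx P))).
  rewrite mul0mx -mulmxA mul_rowsub_mx mulmxV // => /rowP uE0.
  apply/eqP/rowP => k; have := uE0 (enum_val k); rewrite !mxE.
  rewrite (bigD1 k) //= big1 ?addr0 => [|l lk].
    by rewrite !mxE eqxx mulr1.
  by rewrite !mxE (inj_eq enum_val_inj) (negPf lk) mulr0.
have uY : (u *m E <= kermx K)%MS.
  apply/sub_kermxP; rewrite -mulmxA; exact/sub_kermxP.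
have /rV0Pn[k uk] := u0.
have aD i : a i = D i 0 (enum_val k).
  have /rowP/(_ k) := ua i; rewrite mul_mx_diag !mxE mulrC => /(mulIf uk).
  by move->.
have := enum_valP k; rewrite inE -!aD => /negP; apply.
exact: junta_kernel_content2 qq' uE uY.
Qed.

(** A single term suffices, that of the least j for which the content sum d exceeds 2n - 5 - 2j in
    absolute value; minimality gives |d| <= 2n - 3 - 2j, which for j = 0 is [content2_le]. *)
Lemma content_power_le r k :
  (D q 0 k + D q' 0 k) ^+ (2 * r) <=
  \sum_(j < n) (~~ (`|D q 0 k + D q' 0 k| <= 2 * (n%:R - j.+2%:R) - 1))%:R *
     ((2 * n - 3 - 2 * j) ^ (2 * r))%:R.
Proof.
set d := _ + _; have kc := row_content k.
have dR : d \is Num.real by rewrite realD ?(content_real _ kc).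
have n_ge2 : (2 <= n)%N by have := ltn_ord q'; lia.
have large : exists j, ~~ (`|d| <= 2 * (n%:R - j.+2%:R) - 1).
  (* At j = n - 1 the bound is -3. *)
  exists n.-1; rewrite prednK ?(ltnW n_ge2) //.
  have -> : 2 * (n%:R - n.+1%:R) - 1 = - 3 :> C by ring.
  by apply/negP => /(le_trans (normr_ge0 _)); rewrite oppr_ge0 lern0.
case: (ex_minnP large) => j dj jmin.
have jn : (j < n)%N.
  have [/jmin|] := boolP (~~ (`|d| <= 2 * (n%:R - n.-1.+2%:R) - 1)); first lia.
  rewrite negbK prednK ?(ltnW n_ge2) //.
  have -> : 2 * (n%:R - n.+1%:R) - 1 = - 3 :> C by ring.
  by move=> /(le_trans (normr_ge0 _)); rewrite oppr_ge0 lern0.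
have dle : `|d| <= (2 * n - 3 - 2 * j)%:R.
  apply: (@le_trans _ _ ((2 * n)%:R - (3 + 2 * j)%:R)); last first.
    by rewrite lerBlDr -natrD ler_nat; lia.
  case: j jmin {dj jn} => [|j] jmin.
    apply: le_trans (content2_le qq' kc) _.
    by rewrite le_eqVlt; apply/orP; left; apply/eqP; ring.
  have : `|d| <= 2 * (n%:R - j.+2%:R) - 1.
    by apply: contraT => /jmin; rewrite ltnn.
  by move/le_trans; apply; rewrite le_eqVlt; apply/orP; left; apply/eqP; ring.
rewrite (bigD1 (Ordinal jn)) //= dj mul1r ler_wpDr //.
  by apply: sumr_ge0 => l _; rewrite mulr_ge0 ?ler0n.
rewrite exprM -real_normK // -exprM natrX lerXn2r ?nnegrE ?ler0n //.
Qed.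

Lemma trace_content_power r :
  \sum_k (D q 0 k + D q' 0 k) ^+ (2 * r) <=
  (\sum_(j < n) (2 * n ^ (2 * j)) * (2 * n - 3 - 2 * j) ^ (2 * r))%:R.
Proof.
apply: le_trans (ler_sum _ (fun k _ => content_power_le r k)) _.
rewrite exchange_big /= natr_sum; apply: ler_sum => j _.
rewrite -mulr_suml natrM ler_wpM2r ?ler0n // -natr_sum ler_nat.
apply: leq_trans _ (card_large_content j).
rewrite -[leqRHS]sum1_card [leqRHS]big_mkcond /=; apply: leq_sum => k _.
by rewrite inE; case: ifP.
Qed.

End Counting.

Lemma trace_power_le (q q' : 'I_n) r : q' = q.+1 :> nat ->
  \tr ((J q + J q') ^+ (2 * r)) <=
  (\sum_(j < n) (2 * n ^ (2 * j)) * (2 * n - 3 - 2 * j) ^ (2 * r))%:R.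
Proof.
move=> qq'; have [P Pu [D PJ]] := jucys_murphy_diag.
apply: le_trans (trace_content_power Pu PJ qq' r).
pose d : 'rV[C]_N := \row_k (D q 0 k + D q' 0 k).
have PX s : P *m (J q + J q') ^+ s = diag_mx (\row_k d 0 k ^+ s) *m P.
  elim: s => [|s IHs].
    rewrite expr0 mulmx1 -[LHS]mul1mx; congr (_ *m _).
    by apply/matrixP => i k; rewrite !mxE.
  rewrite exprSr mulmxA IHs -mulmxA mulmxDr !PJ -mulmxDl mulmxA; congr (_ *m _).
  rewrite -(raddfD diag_mx) mulmx_diag; congr diag_mx.
  by apply/rowP => k; rewrite !mxE exprSr.
rewrite -[_ ^+ _](mulKmx Pu) PX mxtrace_mulC -mulmxA mulmxV // mulmx1.
rewrite mxtrace_diag.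
by apply: ler_sum => k _; rewrite !mxE.
Qed.

End TraceBound.
(** * Words in the 3-cycles *)

Section WordCount.
Variables (gT : finGroupType) (S : pred gT).

(** The number of ways to write x as a product of k elements of [S]. *)
Fixpoint word_count k : gT -> nat :=
  if k is k'.+1 then fun x => (\sum_(g | S g) word_count k' (g^-1 * x)%g)%N
  else fun x => x == 1%g.

Variable C : numClosedFieldType.
Local Notation rho := (@regmx C gT).

Lemma word_countE k :
  (\sum_(g | S g) rho g) ^+ k = \sum_x (word_count k x)%:R *: rho x.
Proof.
elim: k => [|k IHk].
  rewrite expr0 (bigD1 1%g) //= big1 ?addr0 ?regmx1 ?eqxx ?scale1r //.
  by move=> x /negPf -> ; rewrite scale0r.
rewrite exprS IHk mulr_suml.
under eq_bigr do rewrite mulr_sumr.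
transitivity (\sum_(g | S g) \sum_x (word_count k (g^-1 * x)%g)%:R *: rho x).
  apply: eq_bigr => g _; rewrite (reindex_inj (mulgI g^-1%g)) /=.
  apply: eq_bigr => x _.
  by rewrite -mulmxE -scalemxAr -regmxM mulKVg.
rewrite exchange_big /=; apply: eq_bigr => x _.
by rewrite -scaler_suml natr_sum.
Qed.

Lemma mxtrace_regmx x : \tr (rho x) = (#|gT| * (x == 1%g))%:R.
Proof.
rewrite /mxtrace; under eq_bigr => k _.
  rewrite mxE -{1}[enum_val k]mul1g (inj_eq (mulIg _)) eq_sym; over.
by rewrite sumr_const card_ord natrM mulr_natl.
Qed.

Lemma mxtrace_word_count k :
  \tr ((\sum_(g | S g) rho g) ^+ k) = (#|gT| * word_count k 1)%:R.
Proof.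
rewrite word_countE raddf_sum (bigD1 1%g) //= big1 ?addr0.
  by rewrite mxtraceZ mxtrace_regmx eqxx muln1 -natrM mulnC.
by move=> x /negPf xN1; rewrite mxtraceZ mxtrace_regmx xN1 muln0 mulr0.
Qed.

End WordCount.

(** * The steps of the walk in terms of Jucys-Murphy elements *)

Definition alt_support n (s : {perm 'I_n}) : bool :=
  (s == 1%g) || alt_generator s.

Section AltGenerators.
Variables (n : nat) (a b : 'I_n).
Hypotheses (aE : a.+2 = n) (bE : b.+1 = n).
Local Notation small := (fun i : 'I_n => (i.+2 < n)%N).

Lemma alt_generatorE s : alt_generator s =
  [exists i, small i && ((s == three_cycle i a b) || (s == three_cycle i b a))].
Proof.
apply/existsP/existsP => -[i].
  case/existsP=> a' /existsP[b' /and4P[i_lt /eqP a'E /eqP b'E s_gen]].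
  exists i; rewrite i_lt /=.
  have -> : a = a' by apply: val_inj => /=; lia.
  by have -> : b = b' by apply: val_inj => /=; lia.
case/andP=> i_lt s_gen; exists i; apply/existsP; exists a; apply/existsP.
by exists b; rewrite i_lt aE bE !eqxx.
Qed.

Lemma small_neq i : small i -> [/\ i != a, i != b & a != b].
Proof. by move=> i_lt; split; rewrite -val_eqE /=; lia. Qed.

Lemma three_cycleE i : small i ->
  [/\ three_cycle i a b i = a, three_cycle i a b a = b
    & three_cycle i a b b = i] /\
  [/\ three_cycle i b a i = b, three_cycle i b a b = a
    & three_cycle i b a a = i].
Proof.
move=> /small_neq[ia ib ab]; have ba : b != a by rewrite eq_sym.
rewrite /three_cycle !permM !tpermL !tpermR.
by rewrite (tpermD ia ba) (tpermD ib ab) !tpermL !tpermR.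
Qed.

Lemma three_cycle_eq1 i : small i ->
  (three_cycle i a b == 1%g) = false /\ (three_cycle i b a == 1%g) = false.
Proof.
move=> i_lt; have [ia ib _] := small_neq i_lt.
have [[h _ _] [h' _ _]] := three_cycleE i_lt.
split; apply/eqP => /permP/(_ i); rewrite perm1 ?h ?h' => /esym/eqP.
  by rewrite (negPf ia).
by rewrite (negPf ib).
Qed.

(** The steps are pairwise distinct: the image of b, or of a in the second family, recovers i, and a
    is sent to b in the first family but never in the second. *)
Lemma big_alt_support (V : nmodType) (F : {perm 'I_n} -> V) :
  \sum_(s | alt_support s) F s =
  F 1%g + \sum_(i | small i) (F (three_cycle i a b) + F (three_cycle i b a)).
Proof.
pose A := [set three_cycle i a b | i in small].
pose B := [set three_cycle i b a | i in small].
have AB : [disjoint A & B].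
  rewrite -setI_eq0; apply/eqP/setP => s; rewrite !inE.
  apply/negP => /andP[/imsetP[i il ->] /imsetP[k kl]] /permP/(_ a).
  have [[_ -> _] _] := three_cycleE il; have [_ [_ _ ->]] := three_cycleE kl.
  by have [_ kNb _] := small_neq kl; move=> bk; rewrite bk eqxx in kNb.
rewrite (bigD1 1%g) /=; last by rewrite /alt_support eqxx.
congr (_ + _).
rewrite (eq_bigl [in [predU A & B]]) => [|s].
  rewrite big_split /= bigU //=; congr (_ + _); rewrite big_imset //=.
    move=> i k il kl /permP/(_ b).
    have [[_ _ ->] _] := three_cycleE il.
    by have [[_ _ ->] _] := three_cycleE kl.
  move=> i k il kl /permP/(_ a).
  have [_ [_ _ ->]] := three_cycleE il.
  by have [_ [_ _ ->]] := three_cycleE kl.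
rewrite /alt_support andb_orl andbN /= alt_generatorE inE /=.
apply/andP/orP => [[/existsP[i /andP[il /orP[]/eqP->]] _]|].
- by left; apply/imsetP; exists i.
- by right; apply/imsetP; exists i.
case=> /imsetP[i il ->].
  rewrite (three_cycle_eq1 il).1; split=> //; apply/existsP; exists i.
  by apply/andP; split; rewrite ?eqxx.
rewrite (three_cycle_eq1 il).2; split=> //; apply/existsP; exists i.
by apply/andP; split; rewrite ?eqxx ?orbT.
Qed.

Lemma alt_support_in_Alt s : alt_support s -> s \in Alt 'I_n.
Proof.
case/orP=> [/eqP ->|]; first exact: group1.
rewrite alt_generatorE => /existsP[i /andP[/small_neq[ia ib _] s_gen]].
by rewrite Alt_even; case/orP: s_gen => /eqP ->;
  rewrite /three_cycle odd_permM !odd_tperm ia ib.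
Qed.

Variable C : numClosedFieldType.
Local Notation rho := (@regmx C {perm 'I_n}).
Local Notation J := (@jucys_murphy C n).

(** The identity is (a b)(a b), where (a b) is a term of J_b, and the 3-cycles are (i b)(a b) and (i
    a)(a b). *)
Lemma alt_support_jucys_murphy :
  \sum_(s | alt_support s) rho s = (J a + J b) *m rho (tperm a b).
Proof.
have ab : b = a.+1 :> nat by lia.
rewrite big_alt_support mulmxDl [J b](bigD1 a) /=; last by rewrite ab.
rewrite mulmxDl -regmxM tperm2 addrCA; congr (_ + _).
rewrite !mulmx_suml big_split /=.
have cycleE (i x y : 'I_n) : x != y -> i != x ->
    (three_cycle i x y = tperm i y * tperm x y)%g.
  move=> xy ix; rewrite /three_cycle tperm_shift tpermL (@tpermD _ i y x) //.
    by rewrite [tperm y x]tpermC.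
  by rewrite eq_sym.
rewrite addrC; congr (_ + _); apply: eq_big => i; try lia.
- move=> /small_neq[ia ib ab']; rewrite -regmxM cycleE 1?[tperm b a]tpermC //.
  by rewrite eq_sym.
- by rewrite -val_eqE /= ab; lia.
- by move=> /small_neq[ia ib ab']; rewrite -regmxM cycleE.
Qed.

Lemma jucys_murphy_sum_comm (i j : 'I_n) : j = i.+1 :> nat ->
  (J i + J j) *m rho (tperm i j) = rho (tperm i j) *m (J i + J j).
Proof.
move=> ij; rewrite mulmxDl mulmxDr (jucys_murphy_swapl _ ij).
by rewrite (jucys_murphy_swapr _ ij) addrC addrA addrAC addrK.
Qed.

End AltGenerators.

Lemma card_perm_ord n : #|{perm 'I_n}| = n`!.
Proof.
rewrite -[in RHS](card_ord n) -alt.card_Sym; apply: eq_card => s.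
by rewrite !inE.
Qed.

(** The factor (a b) commutes with J_a + J_b and has square 1, so it drops out of the power 2r; the
    left side is a trace in the regular representation of S_n. *)
Lemma alt_word_count_le n (a b : 'I_n) r : a.+2 = n -> b.+1 = n ->
  (n`! * word_count (@alt_support n) (2 * r) 1 <=
   \sum_(j < n) (2 * n ^ (2 * j)) * (2 * n - 3 - 2 * j) ^ (2 * r))%N.
Proof.
move=> aE bE; have ab : b = a.+1 :> nat by lia.
rewrite -(ler_nat algC); apply: le_trans (trace_power_le algC r ab).
rewrite -card_perm_ord -mxtrace_word_count (alt_support_jucys_murphy aE bE).
set X := _ + _; set s := regmx _ _.
have Xs : GRing.comm X s by rewrite /GRing.comm -!mulmxE jucys_murphy_sum_comm.
rewrite -[X *m s]/(X * s) exprMn_comm // [s ^+ _]exprM.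
have -> : s ^+ 2 = 1 by rewrite expr2 -mulmxE -regmxM tperm2 regmx1.
by rewrite expr1n mulr1.
Qed.
(** * Convolution powers and total variation *)

Section Convolution.
Variables (R : realType) (G : finGroupType).
Implicit Types (p q mu nu : G -> R) (x y g : G).

Lemma convolutionE p q x : convolution p q x = \sum_g p g * q (g^-1 * x)%g.
Proof.
rewrite /convolution (reindex_inj (inj_comp (mulIg x) (@invg_inj G))) /=.
by apply: eq_bigr => g _; rewrite invMg invgK mulKVg.
Qed.

Lemma conv_powS p k x :
  conv_pow p k.+1 x = \sum_g p g * conv_pow p k (g^-1 * x)%g.
Proof. exact: convolutionE. Qed.

Lemma conv_powD p k l x :
  conv_pow p (k + l) x = convolution (conv_pow p k) (conv_pow p l) x.
Proof.
elim: k x => [|k IHk] x.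
  rewrite convolutionE (bigD1 1%g) //= big1 ?addr0.
    by rewrite /point_mass eqxx mul1r invg1 mul1g.
  by move=> g /negPf gN1; rewrite /conv_pow /= /point_mass gN1 mul0r.
rewrite addSn conv_powS; under eq_bigr do rewrite IHk mulr_sumr.
rewrite exchange_big; apply: eq_bigr => y _; rewrite conv_powS mulr_suml.
by apply: eq_bigr => g _; rewrite mulrA mulgA.
Qed.

Lemma conv_pow1 p : conv_pow p 1 =1 p.
Proof.
move=> x; rewrite /conv_pow /= /convolution (bigD1 1%g) //= big1 ?addr0.
  by rewrite /point_mass eqxx invg1 mulg1 mulr1.
by move=> g /negPf gN1; rewrite /point_mass gN1 mulr0.
Qed.

Lemma conv_pow_sym p k : (forall x, p x^-1%g = p x) ->
  forall x, conv_pow p k x^-1%g = conv_pow p k x.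
Proof.
move=> psym; elim: k => [|k IHk] x.
  by rewrite /conv_pow /= /point_mass invg_eq1.
rewrite conv_powS -addn1 conv_powD (reindex_inj invg_inj).
apply: eq_bigr => g _; rewrite conv_pow1 psym mulrC -IHk; congr (_ * _).
by rewrite invMg !invgK.
Qed.

Lemma conv_pow_prob p k : is_prob p -> is_prob (conv_pow p k).
Proof.
move=> [p0 p1]; elim: k => [|k [k0 k1]].
  split=> [x|]; first by rewrite ler0n.
  rewrite (bigD1 1%g) //= big1 ?addr0 /conv_pow /= /point_mass ?eqxx //.
  by move=> x /negPf ->.
split=> [x|]; first by apply: sumr_ge0 => y _; rewrite mulr_ge0.
under eq_bigr do rewrite conv_powS.
rewrite exchange_big /= -[RHS]p1; apply: eq_bigr => g _.
rewrite -mulr_sumr (reindex_inj (mulgI g)) /=.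
by under eq_bigr do rewrite mulKg; rewrite k1 mulr1.
Qed.

Lemma kernel_pow_walk p k x y :
  kernel_pow (walk_kernel p) k x y = conv_pow p k (x^-1 * y)%g.
Proof.
elim: k x => [|k IHk] x.
  by rewrite /conv_pow /= /point_mass -eq_mulVg1.
rewrite conv_powS /= [LHS](reindex_inj (mulgI x)) /=; apply: eq_bigr => g _.
by rewrite IHk /walk_kernel mulKg invMg mulgA.
Qed.

Lemma uniform_prob : is_prob (uniform_dist R G).
Proof.
have G0 : #|G|%:R != 0 :> R by rewrite pnatr_eq0 -cardsT -lt0n cardG_gt0.
split=> [x|]; first by rewrite invr_ge0 ler0n.
by rewrite sumr_const -[_ *+ _]mulr_natr mulVf.
Qed.

(** For a symmetric p, the return probability after 2k steps is the sum of the squares of the k-step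
    probabilities. *)
Lemma conv_pow_sqdist p k : (forall x, p x^-1%g = p x) -> is_prob p ->
  \sum_x (conv_pow p k x - uniform_dist R G x) ^+ 2 =
  conv_pow p (2 * k) 1%g - #|G|%:R^-1.
Proof.
move=> psym pP; have [_ s1] := conv_pow_prob k pP; have [_ u1] := uniform_prob.
have -> : conv_pow p (2 * k) 1%g = \sum_x conv_pow p k x ^+ 2.
  rewrite mul2n -addnn conv_powD; apply: eq_bigr => x _.
  by rewrite mul1g conv_pow_sym // expr2.
rewrite (eq_bigr (fun x => conv_pow p k x ^+ 2
    - (#|G|%:R^-1 *+ 2 * conv_pow p k x - #|G|%:R^-1 * uniform_dist R G x))).
  by rewrite sumrB sumrB -!mulr_sumr s1 u1 !mulr1 mulr2n addrK.
by move=> x _; rewrite /uniform_dist; ring.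
Qed.

(** Cauchy-Schwarz, by expanding the sum of (u x - u y)^2 over all pairs. *)
Lemma sqr_sum_le (T : finType) (u : T -> R) :
  (\sum_x u x) ^+ 2 <= #|T|%:R * \sum_x u x ^+ 2.
Proof.
set S := \sum_x u x; set Q := \sum_x u x ^+ 2.
have inner (x : T) :
    \sum_y (u x - u y) ^+ 2 = #|T|%:R * u x ^+ 2 - 2 * S * u x + Q.
  rewrite (eq_bigr (fun y : T => u x ^+ 2 - 2 * u x * u y + u y ^+ 2)).
    rewrite big_split sumrB sumr_const /= -mulr_sumr -/S -/Q -[_ *+ _]mulr_natl.
    by ring.
  by move=> y _; ring.
have : 0 <= \sum_x \sum_y (u x - u y) ^+ 2.
  by apply: sumr_ge0 => x _; apply: sumr_ge0 => y _; apply: sqr_ge0.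
have -> : \sum_x \sum_y (u x - u y) ^+ 2 = (#|T|%:R * Q - S ^+ 2) *+ 2.
  under eq_bigr do rewrite inner.
  rewrite big_split sumrB sumr_const /= -!mulr_sumr -/S -/Q.
  rewrite -[_ *+ #|_|]mulr_natl.
  by ring.
by rewrite pmulrn_lge0 // subr_ge0.
Qed.

Lemma mass_dist_le mu nu (A : {set G}) :
  `|mass mu A - mass nu A| <= \sum_x `|mu x - nu x|.
Proof.
rewrite /mass -sumrB; apply: le_trans (ler_norm_sum _ _ _) _.
by rewrite big_mkcond; apply: ler_sum => x _; case: ifP.
Qed.

Lemma mass_le_tv_dist mu nu (A : {set G}) :
  `|mass mu A - mass nu A| <= tv_dist mu nu.
Proof.
apply: ub_le_sup; last by exists A.
by exists (\sum_x `|mu x - nu x|) => _ [B _ <-]; apply: mass_dist_le.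
Qed.

Lemma tv_dist_le mu nu (d : R) :
  (forall A : {set G}, `|mass mu A - mass nu A| <= d) -> tv_dist mu nu <= d.
Proof.
move=> le_d; apply: ge_sup => [|_ [A _ <-]] //.
by exists `|mass mu finset.set0 - mass nu finset.set0|, finset.set0.
Qed.

Lemma tv_dist_ge0 mu nu : 0 <= tv_dist mu nu.
Proof. exact: le_trans (mass_le_tv_dist mu nu finset.set0). Qed.

Lemma mass_itv mu (A : {set G}) : is_prob mu -> 0 <= mass mu A <= 1.
Proof.
move=> [mu0 mu1]; rewrite sumr_ge0 //= -mu1 [leRHS](bigID (mem A)) /= lerDl.
exact: sumr_ge0.
Qed.

Lemma tv_dist_le1 mu nu : is_prob mu -> is_prob nu -> tv_dist mu nu <= 1.
Proof.
move=> muP nuP; apply: tv_dist_le => A.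
have /andP[] := mass_itv A muP; have /andP[] := mass_itv A nuP.
by move=> *; rewrite ler_norml; lra.
Qed.

Lemma tv_dist_sqr_le p k : (forall x, p x^-1%g = p x) -> is_prob p ->
  tv_dist (conv_pow p k) (uniform_dist R G) ^+ 2 <=
  #|G|%:R * conv_pow p (2 * k) 1%g - 1.
Proof.
move=> psym pP; have G0 : #|G|%:R != 0 :> R.
  by rewrite pnatr_eq0 -cardsT -lt0n cardG_gt0.
set mu := conv_pow p k; set nu := uniform_dist R G.
have : tv_dist mu nu ^+ 2 <= (\sum_x `|mu x - nu x|) ^+ 2.
  have le_l1 : tv_dist mu nu <= \sum_x `|mu x - nu x|.
    by apply: tv_dist_le; apply: mass_dist_le.
  by rewrite lerXn2r ?nnegrE // ?tv_dist_ge0 // (le_trans _ le_l1) ?tv_dist_ge0.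
move/le_trans; apply; apply: le_trans (sqr_sum_le _) _.
under eq_bigr do rewrite real_normK ?num_real //.
by rewrite conv_pow_sqdist // mulrBr mulfV.
Qed.

(** A point where the k-step probability vanishes contributes |G|^-2 by itself to the squared L^2
    distance. *)
Lemma conv_pow_gt0 p k x : (forall x, p x^-1%g = p x) -> is_prob p ->
  #|G|%:R * conv_pow p (2 * k) 1%g - 1 < #|G|%:R^-1 -> 0 < conv_pow p k x.
Proof.
move=> psym pP lt1; have G_gt0 : 0 < #|G|%:R :> R.
  by rewrite ltr0n -cardsT cardG_gt0.
have [k0 _] := conv_pow_prob k pP; rewrite lt0r k0 andbT; apply/eqP => kx0.
have : #|G|%:R^-1 ^+ 2 <= conv_pow p (2 * k) 1%g - #|G|%:R^-1.
  rewrite -conv_pow_sqdist // (bigD1 x) //= kx0 sub0r sqrrN lerDl.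
  by apply: sumr_ge0 => y _; apply: sqr_ge0.
rewrite -(ler_pM2l G_gt0) mulrBr mulfV ?lt0r_neq0 // expr2 mulrA.
rewrite mulfV ?lt0r_neq0 //.
by rewrite mul1r => /(lt_le_trans lt1); rewrite ltxx.
Qed.

End Convolution.
(** * The walk on the alternating group *)

Section AltWalk.
Variables (R : realType) (m : nat).
Local Notation n := m.+3.
Local Notation G := (subg_of (Alt_group 'I_n)).
Local Notation p := (@alt_walk R n).
Local Notation small := (fun i : 'I_n => (i.+2 < n)%N).

Definition last1 : 'I_n := inord m.+1.
Definition last2 : 'I_n := ord_max.

Lemma last1E : last1.+2 = n. Proof. by rewrite inordK. Qed.
Lemma last2E : last2.+1 = n. Proof. by []. Qed.

Definition nb_gen : R := 2 * n%:R - 3.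

Lemma nb_genE : nb_gen = (2 * n - 3)%:R.
Proof. by rewrite natrB ?natrM //; lia. Qed.

Lemma nb_gen_gt0 : 0 < nb_gen.
Proof. by rewrite nb_genE ltr0n; lia. Qed.

Lemma alt_walkE (x : G) : p x = (alt_support (sgval x))%:R / nb_gen.
Proof.
rewrite /alt_walk /alt_support -/nb_gen -(inj_eq val_inj x 1%g).
by case: ifP => _; rewrite ?mul1r ?mul0r.
Qed.

Lemma sum_subg (F : {perm 'I_n} -> R) :
  \sum_(x : G) F (sgval x) = \sum_(s in Alt_group 'I_n) F s.
Proof.
rewrite [RHS](reindex_onto sgval (subg (Alt_group 'I_n))) /=; last first.
  by move=> s sA; rewrite subgK.
by apply: eq_bigl => x; rewrite subgP sgvalK eqxx.
Qed.

Lemma sum_alt_walk (F : {perm 'I_n} -> R) :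
  \sum_(x : G) p x * F (sgval x) = nb_gen^-1 * \sum_(s | alt_support s) F s.
Proof.
rewrite (eq_bigr (fun x => (alt_support (sgval x))%:R / nb_gen * F (sgval x))).
  rewrite (sum_subg (fun s => (alt_support s)%:R / nb_gen * F s)).
  rewrite mulr_sumr big_mkcond [RHS]big_mkcond /=; apply: eq_bigr => s _.
  case: (boolP (alt_support s)) => [s_gen|_]; last by rewrite !mul0r if_same.
  by rewrite (alt_support_in_Alt last1E last2E s_gen) mul1r.
by move=> x _; rewrite alt_walkE.
Qed.

Lemma sum_small_const (c : R) : \sum_(i : 'I_n | small i) c = c *+ m.+1.
Proof.
rewrite (eq_bigl (fun i : 'I_n => (i < m.+1)%N)) //.
by rewrite (big_ord_narrow (ltnW (ltnW (ltnSn _)))) sumr_const card_ord.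
Qed.

Lemma alt_walk_prob : is_prob p.
Proof.
split=> [x|].
  by rewrite alt_walkE mulr_ge0 ?ler0n // invr_ge0 ltW ?nb_gen_gt0.
transitivity (\sum_(x : G) p x * 1).
  by under [RHS]eq_bigr do rewrite mulr1.
rewrite (sum_alt_walk (fun=> 1)) (big_alt_support last1E last2E).
rewrite sum_small_const.
rewrite -[RHS](mulVf (lt0r_neq0 nb_gen_gt0)) /nb_gen; congr (_ * _).
by rewrite -[_ *+ _]mulr_natr; ring.
Qed.

Lemma alt_supportV (s : {perm 'I_n}) : alt_support s^-1 = alt_support s.
Proof.
suff sub (t : {perm 'I_n}) : alt_support t -> alt_support t^-1.
  by apply/idP/idP => /sub; rewrite ?invgK.
rewrite /alt_support invg_eq1 !(alt_generatorE last1E last2E).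
case/orP=> [->//|/existsP[i /andP[i_small t_gen]]].
apply/orP; right; apply/existsP; exists i; rewrite i_small /= orbC.
by case/orP: t_gen => /eqP ->; rewrite invMg !tpermV eqxx ?orbT.
Qed.

Lemma alt_walk_sym (x : G) : p x^-1%g = p x.
Proof. by rewrite !alt_walkE alt_supportV. Qed.

Lemma conv_pow_alt_walk k (x : G) :
  conv_pow p k x = (word_count (@alt_support n) k (sgval x))%:R / nb_gen ^+ k.
Proof.
elim: k x => [|k IHk] x.
  by rewrite expr0 divr1 /conv_pow /= /point_mass -(inj_eq val_inj x 1%g).
rewrite conv_powS; under eq_bigr do rewrite IHk.
pose F s := (word_count (@alt_support n) k (s^-1 * sgval x)%g)%:R / nb_gen ^+ k.
rewrite (sum_alt_walk F) exprS invfM /= natr_sum mulrCA -mulr_suml.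
by rewrite mulrA.
Qed.

Lemma card_alt_group : (2 * #|{: G}| = n`!)%N.
Proof.
rewrite -[in RHS](card_ord n) -card_Alt ?card_ord //; congr (2 * _)%N.
rewrite -cardsT -(card_imset _ val_inj); apply: eq_card => s.
apply/imsetP/idP => [[x _ ->]|sA]; first exact: subgP.
by exists (subg (Alt_group 'I_n) s); rewrite ?subgK.
Qed.

(** This is 1 - t <= exp (- t) at t = 2j / (2n - 3); past t = 1 the truncated difference is 0. *)
Lemma gap_ratio_le (j k : nat) :
  ((2 * n - 3 - 2 * j)%:R / nb_gen) ^+ (2 * k) <=
  expR (- (4 * k%:R / nb_gen)) ^+ j.
Proof.
have g_gt0 := nb_gen_gt0.
have -> : expR (- (4 * k%:R / nb_gen)) ^+ j =
    expR (- (2 * j%:R / nb_gen)) ^+ (2 * k).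
  by rewrite -!expRM_natl; congr expR; rewrite natrM; field; apply: lt0r_neq0.
rewrite lerXn2r ?nnegrE ?expR_ge0 ?divr_ge0 ?ler0n ?(ltW g_gt0) //.
have [jn|jn] := leqP (2 * j) (2 * n - 3); last first.
  have -> : (2 * n - 3 - 2 * j = 0)%N by lia.
  by rewrite mul0r expR_ge0.
apply: le_trans _ (expR_ge1Dx _).
rewrite natrB // -nb_genE natrM mulrBl mulfV ?lt0r_neq0 //.
Qed.

(** As n! = 2 |A_n|, the factors 2 cancel: the term j = 0 of the trace bound becomes the subtracted
    1, and the others become powers of n^2 exp (- 4k / (2n - 3)). *)
Lemma conv_pow_alt_return k :
  #|{: G}|%:R * conv_pow p (2 * k) 1%g - 1 <=
  \sum_(j < m.+2) (n%:R ^+ 2 * expR (- (4 * k%:R / nb_gen))) ^+ j.+1.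
Proof.
have g_gt0 : 0 < nb_gen ^+ (2 * k) by rewrite exprn_gt0 // nb_gen_gt0.
rewrite conv_pow_alt_walk /= lerBlDl.
have := alt_word_count_le k last1E last2E.
rewrite -card_alt_group -(ler_nat R) big_ord_recl /= !muln0 subn0 expn0 muln1.
rewrite natrD !natrM natr_sum => le_wc.
rewrite -(ler_pM2l (ltr0Sn _ 1)) -(ler_pM2r g_gt0) !mulrA mulfVK ?lt0r_neq0 //.
apply: le_trans le_wc _.
have D (S g : R) : 2 * (1 + S) * g = 2 * g + 2 * (S * g) by ring.
rewrite D natrX -nb_genE lerD2l.
rewrite mulr_suml mulr_sumr; apply: ler_sum => j _.
rewrite /bump leq0n add1n !natrM !natrX exprM -mulrA ler_wpM2l //.
rewrite [(_ * expR _) ^+ _]exprMn -[leRHS]mulrA ler_wpM2l ?exprn_ge0 //.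
by rewrite -ler_pdivrMr // -exprVn -exprMn gap_ratio_le.
Qed.

Lemma conv_pow_alt_return_le k :
  n%:R ^+ 2 * expR (- (4 * k%:R / nb_gen)) <= 2^-1 ->
  #|{: G}|%:R * conv_pow p (2 * k) 1%g - 1 <=
  2 * (n%:R ^+ 2 * expR (- (4 * k%:R / nb_gen))).
Proof.
have := conv_pow_alt_return k; set y := _ ^+ 2 * _ => le_sum y_le.
have y_ge0 : 0 <= y by rewrite mulr_ge0 ?expR_ge0 ?exprn_ge0.
apply: le_trans le_sum _.
(* The remainder on the left makes the geometric bound inductive in N. *)
suff H N : \sum_(j < N) y ^+ j.+1 + 2 * y * y ^+ N <= 2 * y.
  apply: le_trans (H m.+2); rewrite lerDl.
  by apply: mulr_ge0; [apply: mulr_ge0 | apply: exprn_ge0].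
elim: N => [|N IHN]; first by rewrite big_ord0 expr0 add0r mulr1.
apply: le_trans IHN; rewrite big_ord_recr /= -addrA lerD2l.
have yN : 0 <= y ^+ N by rewrite exprn_ge0.
have y1 : 0 <= 1 - 2 * y by lra.
have := mulr_ge0 (mulr_ge0 y_ge0 yN) y1; rewrite !exprS.
by move: (y ^+ N) => t; lra.
Qed.

End AltWalk.

(** * Irreducibility and aperiodicity *)

Section AltChain.
Variables (R : realType) (m : nat).
Local Notation n := m.+3.
Local Notation G := (subg_of (Alt_group 'I_n)).
Local Notation p := (@alt_walk R n).

(** The L^2 bound serves again: for k large, the squared distance is too small for [conv_pow p k] to
    vanish anywhere. *)
Lemma alt_walk_irreducible : irreducible_chain (walk_kernel p).
Proof.
move=> x y; have g_gt0 := nb_gen_gt0 R m.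
have G_gt0 : 0 < #|{: G}|%:R :> R by rewrite ltr0n -cardsT cardG_gt0.
have G_ge1 : 1 <= #|{: G}|%:R :> R by rewrite ler1n -cardsT cardG_gt0.
pose t : R := n%:R ^+ 2 * (2 * #|{: G}|%:R).
pose k := (Num.truncn (t * nb_gen R m / 4)).+1.
have tk : t < expR (4 * k%:R / nb_gen R m).
  apply: lt_le_trans (expR_ge1Dx _).
  apply: (@lt_trans _ _ (4 * k%:R / nb_gen R m)).
    have kt : t * nb_gen R m / 4 < k%:R by apply: truncnS_gt.
    by rewrite ltr_pdivlMr // [4 * _]mulrC -ltr_pdivrMr.
  by rewrite ltrDr.
have yk : n%:R ^+ 2 * expR (- (4 * k%:R / nb_gen R m)) < (2 * #|{: G}|%:R)^-1.
  rewrite expRN ltr_pdivrMr ?expR_gt0 // mulrC ltr_pdivlMr //.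
  by rewrite mulr_gt0.
exists k; rewrite kernel_pow_walk; apply: conv_pow_gt0.
- exact: alt_walk_sym.
- exact: alt_walk_prob.
apply: le_lt_trans (conv_pow_alt_return_le _) _.
  apply: le_trans (ltW yk) _; rewrite lef_pV2 ?posrE ?mulr_gt0 //.
  by rewrite ler_peMr.
by rewrite -ltr_pdivlMl // -invfM.
Qed.

Lemma alt_walk_aperiodic : aperiodic_chain (walk_kernel p).
Proof.
move=> x d /(_ 1%N isT); rewrite kernel_pow_walk conv_pow1 mulVg.
rewrite alt_walkE /alt_support eqxx mul1r invr_gt0 nb_gen_gt0.
by move=> /(_ isT); rewrite dvdn1 => /eqP.
Qed.

End AltChain.
(** * Lower bound by the second moment method *)

Section Expectation.
Variables (R : realType) (G : finGroupType) (p : G -> R).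
Variables (S : Type) (step : G -> S -> S).
Implicit Types (f h : S -> R) (w : S).

(** The mean of f after k independent steps from w; [S] may record more than the position of the
    walk. *)
Fixpoint expect k f w : R :=
  if k is k'.+1 then \sum_g p g * expect k' f (step g w) else f w.

Lemma expect_sum (I : finType) (P : pred I) k (F : I -> S -> R) w :
  expect k (fun w => \sum_(i | P i) F i w) w = \sum_(i | P i) expect k (F i) w.
Proof.
elim: k w => [//|k IHk] w /=; rewrite [RHS]exchange_big.
apply: eq_bigr => g _ /=.
by rewrite IHk mulr_sumr.
Qed.

Lemma expectD k f h w :
  expect k (fun w => f w + h w) w = expect k f w + expect k h w.
Proof.
elim: k w => [//|k IHk] w /=; rewrite -big_split; apply: eq_bigr => g _ /=.
by rewrite IHk mulrDr.
Qed.

Lemma expectZ k (c : R) f w : expect k (fun w => c * f w) w = c * expect k f w.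
Proof.
elim: k w => [//|k IHk] w /=; rewrite mulr_sumr; apply: eq_bigr => g _ /=.
by rewrite IHk mulrCA.
Qed.

Lemma expect_eigen k (c : R) f :
    (forall w, \sum_g p g * f (step g w) = c * f w) ->
  forall w, expect k f w = c ^+ k * f w.
Proof.
move=> fc; elim: k => [|k IHk] w /=; first by rewrite mul1r.
under eq_bigr do rewrite IHk mulrCA.
by rewrite -mulr_sumr fc mulrA exprSr.
Qed.

Lemma expect_le (inv : S -> Prop) k f h : (forall g, 0 <= p g) ->
    (forall g w, inv w -> inv (step g w)) -> (forall w, inv w -> f w <= h w) ->
  forall w, inv w -> expect k f w <= expect k h w.
Proof.
move=> p0 invS fh; elim: k => [//|k IHk] w w_inv /=.
by apply: ler_sum => g _; rewrite ler_wpM2l // IHk //; apply: invS.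
Qed.

End Expectation.

Lemma expect_conv_pow (R : realType) (G : finGroupType) (p : G -> R) (T : Type)
    (touch : G -> T -> T) k (F : G -> R) x t :
  expect p (fun g w => (g * w.1, touch g w.2))%g k (F \o fst) (x, t) =
  \sum_y conv_pow p k y * F (y * x)%g.
Proof.
elim: k x t => [|k IHk] x t.
  rewrite /= (bigD1 1%g) //= big1 ?addr0 /conv_pow /= /point_mass ?eqxx.
    by rewrite mul1r mul1g.
  by move=> g /negPf ->; rewrite mul0r.
rewrite [LHS]/=; under eq_bigr do rewrite IHk mulr_sumr.
under [RHS]eq_bigr => y _.
  rewrite -addn1 conv_powD /convolution mulr_suml.
  under eq_bigr do rewrite conv_pow1.
  over.
rewrite [RHS]exchange_big; apply: eq_bigr => g _ /=.
rewrite [RHS](reindex_inj (mulIg g)); apply: eq_bigr => y _ /=.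
by rewrite mulgK -mulgA mulrA [p g * _]mulrC.
Qed.

(** * Mean number of fixed points of a permutation *)

Section FixedPoints.
Variables (n : nat).
Local Notation "'Fix x" := #|[set i : 'I_n | x i == i]|
  (at level 8, x at level 2).

(** Multiplication by (i j) shows that x i takes each value equally often, so each i is fixed by n!
    / n permutations; the inequality is strict only at n = 0. *)
Lemma sum_fixed_points : (\sum_(x : {perm 'I_n}) 'Fix x <= n`!)%N.
Proof.
pose c (i j : 'I_n) := #|[set x : {perm 'I_n} | x i == j]|.
have cE i j : c i j = c i i.
  rewrite /c -[RHS](card_imset _ (mulIg (tperm i j))); apply: eq_card => x.
  rewrite inE; apply/eqP/imsetP => [xi|[y]].
    exists (x * tperm i j)%g; first by rewrite inE permM xi tpermR.
    by rewrite -mulgA tperm2 mulg1.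
  by rewrite inE => /eqP yi ->; rewrite permM yi tpermL.
have cn i : (n * c i i = n`!)%N.
  have -> : (n * c i i = \sum_j c i j)%N.
    by under eq_bigr do rewrite cE; rewrite sum_nat_const card_ord.
  rewrite -card_perm_ord -sum1_card.
  rewrite (partition_big (fun x : {perm 'I_n} => x i) predT) //=.
  by apply: eq_bigr => j _; apply: esym; apply: sum1dep_card.
have -> : (\sum_(x : {perm 'I_n}) 'Fix x = \sum_i c i i)%N.
  transitivity (\sum_(x : {perm 'I_n}) \sum_(i | x i == i) 1)%N.
    by apply: eq_bigr => x _; apply: esym; apply: sum1dep_card.
  rewrite (exchange_big_dep predT) //=; apply: eq_bigr => i _.
  exact: sum1dep_card.
have [n0|n_gt0] := posnP n.
  by rewrite big1 // => i _; have := ltn_ord i; lia.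
by rewrite -(leq_pmul2l n_gt0) big_distrr /=; under eq_bigr do rewrite cn;
  rewrite sum_nat_const card_ord.
Qed.

End FixedPoints.

(** * Letters not moved by any step *)

Section LowerBound.
Variables (R : realType) (m : nat).
Local Notation n := m.+3.
Local Notation G := (subg_of (Alt_group 'I_n)).
Local Notation p := (@alt_walk R n).
Local Notation ng := (nb_gen R m).
Local Notation small := (fun i : 'I_n => (i.+2 < n)%N).
Local Notation a := (last1 m).
Local Notation b := (last2 m).
Implicit Types (A T : {set 'I_n}) (x g : G).

Definition moved (s : {perm 'I_n}) : {set 'I_n} := [set i | s i != i].

(* The state is the current position of the walk, together with the set of the
   letters moved by some step. *)
Definition touch_step g (w : G * {set 'I_n}) : G * {set 'I_n} :=
  ((g * w.1)%g, w.2 :|: moved (sgval g)).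

Definition untouched A (w : G * {set 'I_n}) : R := [disjoint A & w.2]%:R.

Lemma disjoint_moved_three_cycle A k : {subset A <= small} -> small k ->
  [disjoint A & moved (three_cycle k a b)] = (k \notin A) /\
  [disjoint A & moved (three_cycle k b a)] = (k \notin A).
Proof.
move=> A_small k_small.
have fixD (i u v : 'I_n) :
    k != i -> u != i -> v != i -> three_cycle k u v i = i.
  by move=> ki ui vi; rewrite permM !tpermD.
have [[ha _ _] [hb _ _]] := three_cycleE (last1E m) (last2E m) k_small.
have [ka kb _] := small_neq (last1E m) (last2E m) k_small.
have main (s : {perm 'I_n}) : s k != k ->
    (forall i, k != i -> a != i -> b != i -> s i = i) ->
    [disjoint A & moved s] = (k \notin A).
  have A_neq i iA := small_neq (last1E m) (last2E m) (A_small i iA).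
  move=> sk s_fix; apply/idP/idP => [dA|kNA].
    by apply/negP => kA; have := disjointFr dA kA; rewrite inE sk.
  apply/pred0P => i /=; apply/negP => /andP[iA]; rewrite inE; apply/negP.
  rewrite negbK; apply/eqP/s_fix.
  - by apply: contraNneq kNA => ->.
  - by have [? _ _] := A_neq i iA; rewrite eq_sym.
  - by have [_ ? _] := A_neq i iA; rewrite eq_sym.
split; apply: main => //.
- by rewrite ha eq_sym.
- by move=> i *; apply: fixD.
- by rewrite hb eq_sym.
- by move=> i *; apply: fixD.
Qed.

(** Neither a nor b lies in A, so a 3-cycle can move A only through its letter i, and each i in A
    rules out two steps. *)
Lemma untouched_prob A : {subset A <= small} ->
  \sum_(g : G) p g * [disjoint A & moved (sgval g)]%:R = 1 - 2 * #|A|%:R / ng.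
Proof.
move=> A_small; have ng_neq0 : ng != 0 by rewrite lt0r_neq0 ?nb_gen_gt0.
rewrite (sum_alt_walk (fun s => [disjoint A & moved s]%:R)).
rewrite (big_alt_support (last1E m) (last2E m)).
have -> : [disjoint A & moved 1] = true.
  by apply/pred0P => i /=; rewrite inE perm1 eqxx andbF.
rewrite (eq_bigr (fun k => 2 - 2 * (k \in A)%:R)) => [|k k_small]; last first.
  have [-> ->] := disjoint_moved_three_cycle A_small k_small.
  by case: (k \in A) => /=; ring.
rewrite sumrB sum_small_const -mulr_sumr.
have -> : \sum_(k : 'I_n | small k) (k \in A)%:R = #|A|%:R :> R.
  rewrite -sum1_card natr_sum big_mkcond [RHS]big_mkcond.
  apply: eq_bigr => k _ /=.
  case: (boolP (k \in A)) => [/A_small|_]; last by rewrite if_same.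
  by rewrite unfold_in => ->.
rewrite -[_ *+ _]mulr_natr /=; move: ng_neq0; rewrite /nb_gen => ng_neq0.
by move: (#|A|%:R) => c; field.
Qed.

(** A remains untouched when each step avoids it, so its indicator is an eigenfunction of one
    step. *)
Lemma expect_untouched A k : {subset A <= small} ->
  expect p touch_step k (untouched A) (1%g, finset.set0) =
  (1 - 2 * #|A|%:R / ng) ^+ k.
Proof.
move=> A_small; rewrite (expect_eigen _ (c := 1 - 2 * #|A|%:R / ng)).
  by rewrite /untouched -finset.setI_eq0 finset.setI0 eqxx mulr1.
move=> w; rewrite -untouched_prob // mulr_suml; apply: eq_bigr => g _.
rewrite -mulrA; congr (_ * _); rewrite /untouched /= -natrM mulnb.
by rewrite -!finset.setI_eq0 finset.setIUr finset.setU_eq0 andbC.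
Qed.

Definition nb_untouched (w : G * {set 'I_n}) : R :=
  \sum_(i : 'I_n | small i) untouched [set i] w.

Local Notation q1 := (1 - 2 / ng).

Definition mean_untouched k : R := m.+1%:R * q1 ^+ k.

Local Notation E k f := (expect p touch_step k f (1%g, finset.set0)).

Lemma expect_cst k (c : R) : E k (fun=> c) = c.
Proof.
rewrite (expect_eigen _ (c := 1)) ?expr1n ?mul1r // => _.
by rewrite -mulr_suml; have [_ ->] := alt_walk_prob R m; rewrite ?mul1r.
Qed.

Lemma expect_nb_untouched k : E k nb_untouched = mean_untouched k.
Proof.
rewrite expect_sum (eq_bigr (fun=> q1 ^+ k)) => [|i i_small].
  by rewrite sum_small_const -[LHS]mulr_natl.
rewrite expect_untouched ?cards1 ?mulr1 // => j.
by rewrite inE => /eqP ->.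
Qed.

(** Distinct letters are nonpositively correlated, because 1 - 4 / ng <= (1 - 2 / ng)^2; the
    diagonal pairs add the mean. Positivity of m gives ng >= 5, so that 1 - 4 / ng >= 0 and the
    inequality can be raised to the power k. *)
Lemma expect_nb_untouched_sqr k : (0 < m)%N ->
  E k (fun w => nb_untouched w ^+ 2) <=
  mean_untouched k ^+ 2 + mean_untouched k.
Proof.
move=> m_gt0; have ng_gt0 := nb_gen_gt0 R m.
have ng_ge5 : 5 <= ng by rewrite nb_genE ler_nat; lia.
have q1_ge0 : 0 <= q1 by rewrite subr_ge0 ler_pdivrMr // mul1r; lra.
have E2 i j : small i -> small j ->
    E k (untouched [set i; j]) <= q1 ^+ k ^+ 2 + (i == j)%:R * q1 ^+ k.
  move=> i_small j_small; rewrite expect_untouched; last first.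
    by move=> l; rewrite !inE => /orP[]/eqP ->.
  rewrite cards2; case: (eqVneq i j) => _ /=.
    by rewrite mulr1 mul1r lerDr exprn_ge0 ?exprn_ge0.
  rewrite mul0r addr0 -exprM mulnC exprM lerXn2r ?nnegrE ?exprn_ge0 //.
    by rewrite subr_ge0 ler_pdivrMr // mul1r; lra.
  rewrite -subr_ge0 (_ : _ - _ = (2 / ng) ^+ 2) ?sqr_ge0 //.
  by field; apply: lt0r_neq0.
have -> : (fun w => nb_untouched w ^+ 2) =
    fun w => \sum_(i | small i) \sum_(j | small j) untouched [set i; j] w.
  apply/funext => w; rewrite expr2 mulr_suml; apply: eq_bigr => i _.
  rewrite mulr_sumr; apply: eq_bigr => j _; rewrite -natrM mulnb /untouched.
  by rewrite -!finset.setI_eq0 finset.setIUl finset.setU_eq0.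
rewrite expect_sum; under eq_bigr do rewrite expect_sum.
apply: (@le_trans _ _
  (\sum_(i : 'I_n | small i) (m.+1%:R * q1 ^+ k ^+ 2 + q1 ^+ k))).
  apply: ler_sum => i i_small.
  apply: le_trans (ler_sum _ (fun j j_small => E2 i j i_small j_small)) _.
  rewrite big_split /= sum_small_const -[_ *+ _]mulr_natl lerD2l -mulr_suml.
  rewrite (bigD1 i) //= eqxx big1 ?addr0 ?mul1r // => j /andP[_ /negPf ji].
  by rewrite eq_sym ji.
by rewrite sum_small_const -[_ *+ _]mulr_natl /mean_untouched le_eqVlt;
  apply/orP; left; apply/eqP; ring.
Qed.

Definition few_fixed (t : R) : {set G} :=
  [set x : G | #|[set i : 'I_n | sgval x i == i]|%:R < t].

(** Chebyshev's inequality: untouched letters are fixed points, so with fewer than M / 2 fixed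
    points the number of untouched letters is at least M / 2 below its mean M, while its variance is
    at most M. *)
Lemma mass_few_fixed_walk k : (0 < m)%N -> 0 < mean_untouched k ->
  mass (conv_pow p k) (few_fixed (mean_untouched k / 2)) <=
  4 / mean_untouched k.
Proof.
move=> m_gt0 M_gt0; set M := mean_untouched k in M_gt0 *; set A := few_fixed _.
pose F x : R := (x \in A)%:R.
have -> : mass (conv_pow p k) A = E k (F \o fst).
  have -> : E k (F \o fst) = _ :=
    expect_conv_pow p (fun g T => T :|: moved (sgval g)) k F 1%g finset.set0.
  rewrite /mass big_mkcond; apply: eq_bigr => x _.
  by rewrite mulg1 /F; case: (x \in A); rewrite ?mulr1 ?mulr0.
pose inv (w : G * {set 'I_n}) := forall i, i \notin w.2 -> sgval w.1 i = i.
(* The quadratic majorant of the indicator [F] in Chebyshev's inequality, valid on states where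
   every unrecorded letter is fixed. *)
pose h w : R := (M / 2) ^- 2 * (nb_untouched w - M) ^+ 2.
have Fh w : inv w -> (F \o fst) w <= h w.
  move=> w_inv; rewrite /= /F inE; case: ltP => [fixed_lt|_] /=; last first.
    by rewrite mulr_ge0 ?sqr_ge0 // invr_ge0 exprn_ge0 // divr_ge0 // ltW.
  rewrite /h mulrC ler_pdivlMr ?exprn_gt0 ?divr_gt0 // mul1r.
  have U_le : nb_untouched w <= M / 2.
    apply: le_trans (ltW fixed_lt); rewrite -sum1_card natr_sum.
    rewrite /nb_untouched big_mkcond [leRHS]big_mkcond.
    apply: ler_sum => i _ /=.
    rewrite /untouched inE finset.disjoints1; case: (boolP (i \in w.2)) => iw.
      by case: ifP => _; case: ifP.
    by rewrite (w_inv i iw) eqxx; case: ifP.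
  have MU : M / 2 <= - (nb_untouched w - M) by move: U_le; lra.
  have M2 : 0 <= M / 2 by rewrite divr_ge0 // ltW.
  by rewrite -[leRHS]sqrrN lerXn2r ?nnegrE // (le_trans M2).
apply: le_trans (expect_le (inv := inv) k _ _ Fh _) _.
- by have [] := alt_walk_prob R m.
- move=> g w w_inv i; rewrite /touch_step /= !inE negb_or negbK.
  by case/andP=> iw /eqP gi; rewrite permM gi w_inv.
- by move=> i _; rewrite perm1.
rewrite expectZ.
have -> : (fun w => (nb_untouched w - M) ^+ 2) =
    fun w => nb_untouched w ^+ 2 + ((- 2 * M) * nb_untouched w + M ^+ 2).
  by apply/funext => w; ring.
rewrite expectD expectD expectZ expect_cst expect_nb_untouched -/M.
have := expect_nb_untouched_sqr k m_gt0; rewrite -/M.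
move: (E k _) => V VM; rewrite mulrC ler_pdivrMr ?exprn_gt0 ?divr_gt0 //.
have -> : 4 / M * (M / 2) ^+ 2 = M by field; apply: lt0r_neq0.
by move: VM; rewrite !expr2; lra.
Qed.

(** Markov's inequality: the fixed points counted over A_n are at most those over S_n, that is n! =
    2 |A_n|, so their mean is at most 2. *)
Lemma mass_few_fixed_uniform (t : R) : 0 < t ->
  1 - 2 / t <= mass (uniform_dist R G) (few_fixed t).
Proof.
move=> t_gt0; have [_ u1] := uniform_prob R G; set A := few_fixed t.
have N_gt0 : 0 < #|{: G}|%:R :> R by rewrite ltr0n -cardsT cardG_gt0.
have -> : mass (uniform_dist R G) A =
    1 - \sum_(x | x \notin A) uniform_dist R G x.
  by rewrite -u1 /mass [X in X - _](bigID (mem A)) /= addrK.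
rewrite lerD2l lerN2 -(ler_pM2l t_gt0) mulr_sumr mulrCA.
rewrite mulfV ?lt0r_neq0 // mulr1.
apply: (@le_trans _ _ (#|{: G}|%:R^-1 *
    (\sum_(x : {perm 'I_n}) #|[set i : 'I_n | x i == i]|)%:R)); last first.
  rewrite mulrC ler_pdivrMr // -natrM ler_nat card_alt_group.
  exact: sum_fixed_points.
rewrite natr_sum mulr_sumr.
apply: (@le_trans _ _ (\sum_(x : G) #|{: G}|%:R^-1 *
    #|[set i : 'I_n | sgval x i == i]|%:R)).
  rewrite [leRHS](bigID (mem A)) /= ler_wpDl //.
    by apply: sumr_ge0 => x _; rewrite mulr_ge0 ?invr_ge0.
  apply: ler_sum => x; rewrite inE -leNgt => tx.
  by rewrite mulrC ler_wpM2l ?invr_ge0.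
rewrite (sum_subg (fun s => #|{: G}|%:R^-1 * #|[set i : 'I_n | s i == i]|%:R)).
rewrite [leRHS](bigID (mem (Alt_group 'I_n))) /= lerDl.
by apply: sumr_ge0 => x _; rewrite mulr_ge0 ?invr_ge0.
Qed.

Lemma tv_dist_alt_walk_ge k : (0 < m)%N -> 0 < mean_untouched k ->
  1 - 8 / mean_untouched k <= tv_dist (conv_pow p k) (uniform_dist R G).
Proof.
move=> m_gt0 M_gt0; have walk := mass_few_fixed_walk m_gt0 M_gt0.
have t_gt0 : 0 < mean_untouched k / 2 by rewrite divr_gt0.
have unif := mass_few_fixed_uniform t_gt0.
apply: le_trans (mass_le_tv_dist _ _ (few_fixed (mean_untouched k / 2))).
rewrite distrC; apply: le_trans (ler_norm _).
apply: le_trans (lerB unif walk).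
have -> : 2 / (mean_untouched k / 2) = 4 / mean_untouched k.
  by field; apply: lt0r_neq0.
have -> : 8 / mean_untouched k = 4 / mean_untouched k + 4 / mean_untouched k.
  by field; apply: lt0r_neq0.
by rewrite opprD addrA.
Qed.

End LowerBound.
(** * Asymptotics *)

Section Cutoff.
Variable R : realType.
Local Open Scope classical_set_scope.
Local Notation L m := (ln (m.+3%:R : R)).
Local Notation tau m := ((m.+3%:R - 3 / 2) * L m).

Lemma near_ge_nat (A : R) : \forall m \near \oo, A <= m%:R.
Proof. exact: nbhs_infty_ger. Qed.

Lemma near_ge_ln (A : R) : \forall m \near \oo, A <= L m.
Proof.
near=> m; rewrite -[A]expRK ler_ln ?posrE ?expR_gt0 //.
apply: (@le_trans _ _ m%:R); last by rewrite ler_nat; lia.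
by near: m; apply: near_ge_nat.
Unshelve. all: by end_near. Qed.

Lemma ln_nat_gt0 m : 0 < L m.
Proof. by rewrite ln_gt0 // ltr1n. Qed.

Lemma tau_gt0 m : 0 < tau m.
Proof.
rewrite mulr_gt0 ?ln_nat_gt0 // subr_gt0.
by apply: (@lt_le_trans _ _ 3); [lra | rewrite ler_nat].
Qed.

Lemma tau_pinfty : tau m @[m --> \oo] --> +oo.
Proof.
apply/cvgryPge => A; near=> m.
apply: (@le_trans _ _ (L m)); first by near: m; apply: near_ge_ln.
have n3 : 3 <= m.+3%:R :> R by rewrite ler_nat.
by rewrite ler_peMl ?ltW ?ln_nat_gt0 //; lra.
Unshelve. all: by end_near. Qed.

Lemma nb_gen_tau m : nb_gen R m = 2 * (m.+3%:R - 3 / 2).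
Proof. by rewrite /nb_gen; field. Qed.

(** As 2n - 3 = 2 (n - 3/2), the exponent 4k / (2n - 3) is about 2 (1 + eps) ln n, which leaves
    n^(-2 eps). Rounding k down costs at most 4 / (2n - 3) <= 2, the constant on the right. *)
Lemma sq_mul_expR_le (eps : R) m k : 0 < eps -> (1 + eps) * tau m - 1 <= k%:R ->
  m.+3%:R ^+ 2 * expR (- (4 * k%:R / nb_gen R m)) <= expR (2 - 2 * eps * L m).
Proof.
move=> eps_gt0 k_ge; have ng_gt0 := nb_gen_gt0 R m.
have n3 : 3 <= m.+3%:R :> R by rewrite ler_nat.
have -> : m.+3%:R ^+ 2 = expR (2 * L m) by rewrite expRM_natl lnK ?posrE.
rewrite -expRD ler_expR.
have : (2 * (1 + eps) * L m - 2) * nb_gen R m <= 4 * k%:R.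
  apply: le_trans (ler_wpM2l _ k_ge) => //.
  rewrite nb_gen_tau; nra.
rewrite -ler_pdivlMr //.
lra.
Qed.

Local Notation G m := (subg_of (Alt_group 'I_m.+3)).
Local Notation p m := (@alt_walk R m.+3).

Lemma upper_cutoff (eps : R) : 0 < eps ->
  tv_dist (conv_pow (p m) (Num.truncn ((1 + eps) * tau m)))
          (uniform_dist R (G m)) @[m --> \oo] --> (0 : R).
Proof.
move=> eps_gt0; apply/cvgr0Pnorm_le => e e_gt0.
(* The first bound yields the squared distance e^2, the second one allows
   [conv_pow_alt_return_le]. *)
pose c := Num.min (e ^+ 2 / 2) (2^-1).
have c_gt0 : 0 < c by rewrite lt_min divr_gt0 ?exprn_gt0 //= invr_gt0.
near=> m; set k := Num.truncn _.
have tau_ge0 : 0 <= (1 + eps) * tau m.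
  by rewrite mulr_ge0 ?(ltW (tau_gt0 m)) // addr_ge0 // ltW.
have k_ge : (1 + eps) * tau m - 1 <= k%:R.
  by rewrite lerBlDr natr1; have /andP[_ /ltW] := truncn_itv tau_ge0.
have y_le : m.+3%:R ^+ 2 * expR (- (4 * k%:R / nb_gen R m)) <= c.
  apply: le_trans (sq_mul_expR_le eps_gt0 k_ge) _.
  rewrite -[c]lnK ?posrE // ler_expR lerBlDl -lerBlDr.
  rewrite -ler_pdivrMl ?mulr_gt0 //.
  by near: m; apply: near_ge_ln.
rewrite ger0_norm ?tv_dist_ge0 // -(@ler_pXn2r _ 2) ?nnegrE ?tv_dist_ge0 //;
  last exact: ltW.
apply: le_trans (tv_dist_sqr_le _ (@alt_walk_sym R m) (alt_walk_prob R m)) _.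
have y_half : m.+3%:R ^+ 2 * expR (- (4 * k%:R / nb_gen R m)) <= 2^-1.
  by apply: le_trans y_le _; rewrite ge_min lexx orbT.
apply: le_trans (conv_pow_alt_return_le y_half) _.
rewrite -ler_pdivlMl // [leRHS]mulrC; apply: le_trans y_le _.
by rewrite ge_min lexx.
Unshelve. all: by end_near. Qed.

(** 1 - 2 / (2n - 3) is the inverse of 1 + 1 / (n - 5/2), hence at least exp (- 1 / (n - 5/2)). Half
    of eps pays for passing from n - 3/2 to n - 5/2, whence the condition 2 / eps <= m; the 3 comes
    from m + 1 >= n / 3. *)
Lemma mean_untouched_ge (eps : R) m k : 0 < eps < 1 ->
    2 / eps <= m%:R -> k%:R <= (1 - eps) * tau m ->
  expR (eps / 2 * L m) / 3 <= mean_untouched R m k.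
Proof.
move=> /andP[eps_gt0 eps_lt1] m_ge k_le; set n : R := m.+3%:R.
have nE : n = m%:R + 3 by rewrite /n -addn3 natrD.
have m_ge0 : 0 <= m%:R :> R by [].
have z_gt0 : 0 < n - 5 / 2 by lra.
have L_gt0 := ln_nat_gt0 m.
have q_ge : expR (- (n - 5 / 2)^-1) <= 1 - 2 / nb_gen R m.
  have -> : 1 - 2 / nb_gen R m = (1 + (n - 5 / 2)^-1)^-1.
    rewrite nb_gen_tau -/n; field.
    by do ?[apply/andP; split]; apply: lt0r_neq0; lra.
  rewrite expRN lef_pV2 ?posrE ?expR_gt0 ?expR_ge1Dx //.
  by rewrite addr_gt0 ?invr_gt0.
have qk_ge : expR (- (k%:R / (n - 5 / 2))) <= (1 - 2 / nb_gen R m) ^+ k.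
  rewrite -mulrN expRM_natl lerXn2r ?nnegrE ?expR_ge0 //.
  exact: le_trans (expR_ge0 _) q_ge.
have expo : k%:R / (n - 5 / 2) <= (1 - eps / 2) * L m.
  rewrite ler_pdivrMr //; apply: le_trans k_le _.
  rewrite -/n mulrA [leRHS]mulrAC ler_wpM2r ?(ltW L_gt0) //.
  have : 2 <= m%:R * eps by rewrite -ler_pdivrMr.
  nra.
rewrite /mean_untouched.
apply: (@le_trans _ _ ((n / 3) * expR (- ((1 - eps / 2) * L m)))).
  have -> : eps / 2 * L m = L m + - ((1 - eps / 2) * L m) by ring.
  by rewrite expRD lnK ?posrE // mulrAC.
apply: ler_pM; rewrite ?expR_ge0 //.
- by rewrite divr_ge0 // /n.
- by rewrite -[leRHS]natr1 nE; lra.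
- by apply: le_trans _ qk_ge; rewrite ler_expR lerN2.
Qed.

Lemma lower_cutoff (eps : R) : 0 < eps < 1 ->
  tv_dist (conv_pow (p m) (Num.truncn ((1 - eps) * tau m)))
          (uniform_dist R (G m)) @[m --> \oo] --> (1 : R).
Proof.
move=> eps01; have /andP[eps_gt0 eps_lt1] := eps01.
apply/cvgrPdist_le => e e_gt0; near=> m; set k := Num.truncn _.
have m_gt0 : (0 < m)%N.
  by rewrite -(ler_nat R); near: m; apply: near_ge_nat.
have m_ge : 2 / eps <= m%:R by near: m; apply: near_ge_nat.
have k_le : k%:R <= (1 - eps) * tau m.
  by rewrite truncn_le mulr_ge0 ?(ltW (tau_gt0 m)) // subr_ge0 ltW.
have M_ge := mean_untouched_ge eps01 m_ge k_le.
have M_large : 8 / e <= mean_untouched R m k.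
  apply: le_trans _ M_ge; rewrite ler_pdivlMr //.
  rewrite -[leLHS]lnK ?posrE ?mulr_gt0 ?invr_gt0 // ler_expR.
  rewrite -ler_pdivrMl ?divr_gt0 //.
  by near: m; apply: near_ge_ln.
have M_gt0 : 0 < mean_untouched R m k.
  by apply: lt_le_trans M_large; rewrite divr_gt0.
rewrite ger0_norm; last first.
  rewrite subr_ge0; apply: tv_dist_le1 (uniform_prob _ _).
  exact: conv_pow_prob (alt_walk_prob R m).
rewrite lerBlDr -lerBlDl; apply: le_trans (tv_dist_alt_walk_ge m_gt0 M_gt0).
by rewrite lerD2l lerN2 ler_pdivrMr // mulrC -ler_pdivrMr.
Unshelve. all: by end_near. Qed.

End Cutoff.

(* The family of the A_n with n >= 3 is indexed from 0 by m = n - 3. *)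
Theorem corollary4p8 (R : realType) :
  tv_cutoff (R := R)
    (G := fun m : nat => [subg 'Alt_('I_m.+3)] : finGroupType)
    (fun m : nat => @alt_walk R m.+3)
    (fun m : nat => (m.+3%:R - 3 / 2) * ln (m.+3%:R)).
Proof.
split.
- move=> m; split; first exact: alt_walk_prob.
    exact: alt_walk_irreducible.
  exact: alt_walk_aperiodic.
- exact: tau_gt0.
- exact: tau_pinfty.
- by move=> eps /andP[eps_gt0 _]; apply: upper_cutoff.
- exact: lower_cutoff.
Qed.
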